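(* Let $C_{abcd}$ be a Weyl tensor of Petrov type $I$ at a point of a spacetime with metric $g_{ab}$ of signature $(+,-,-,-)$, let $T_{abcd}$ be its Bel–Robinson tensor, and let $u^a$ be a future-pointing unit timelike vector. Then the following are equivalent: (i) $u_{[a}T_{b]cde}u^cu^du^e=0$; (ii) $u^a$ is the timelike member of the canonical Petrov tetrad; (iii) $u^a$ is the unique global minimum of the quartic form $t^a\mapsto T_{abcd}t^at^bt^ct^d$ restricted to future-pointing unit timelike vectors $t^a$. Moreover, the minimum value in (iii) equals $\frac{1}{16}\sum_{i=1}^3|\sigma_i|^2$, where $\sigma_1,\sigma_2,\sigma_3$ are the coefficients of the self-dual Weyl tensor in the canonical Petrov tetrad as described below.
   Context: The Bel–Robinson tensor is $T_{abcd}=\Psi_{ABCD}\bar\Psi_{A'B'C'D'}$ with $\Psi_{ABCD}$ the Weyl spinor; equivalently $T_{abcd}=\overset{+}{C}{}^p{}_{ab}{}^q\,\overset{-}{C}_{pcdq}$, where $\overset{+}{C}_{abcd}=\tfrac12(C_{abcd}-i\,{}^{*}C_{abcd})$ is the self-dual part of the Weyl tensor, ${}^*C_{abcd}$ its dual, and $\overset{-}{C}_{abcd}$ the complex conjugate of $\overset{+}{C}_{abcd}$. Given an orthonormal tetrad $v_a,x_a,y_a,z_a$ with $v_a$ timelike, set $F_{ab}=2v_{[a}x_{b]}$, $G_{ab}=2v_{[a}y_{b]}$, $H_{ab}=2v_{[a}z_{b]}$ and $\overset{+}{F}_{ab}=\tfrac12(F_{ab}-i\,{}^*F_{ab})$,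 and similarly $\overset{+}{G}_{ab},\overset{+}{H}_{ab}$. The canonical Petrov tetrad of a type $I$ Weyl tensor is the orthonormal tetrad (unique up to signs and reorderings) in which $\overset{+}{C}_{abcd}=\sigma_1\overset{+}{F}_{ab}\overset{+}{F}_{cd}+\sigma_2\overset{+}{G}_{ab}\overset{+}{G}_{cd}+\sigma_3\overset{+}{H}_{ab}\overset{+}{H}_{cd}$ for complex numbers $\sigma_i$ with $\sigma_1+\sigma_2+\sigma_3=0$ (equivalently, $E_{ab}+iB_{ab}$ is diagonal in it, where $E_{ab}=C_{acdb}v^cv^d$, $B_{ab}={}^*C_{acdb}v^cv^d$); its timelike member $v^a$ is taken future-pointing. *)

(* Defs.v *)
(* Tensors at a point of a 4-dimensional spacetime,
   written in components w.r.t. an arbitrary basis of the tangent space. *)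
From HB Require Import structures.
From mathcomp Require Import all_boot all_order all_algebra.
From mathcomp Require Import complex.
Set Implicit Arguments. Unset Strict Implicit. Unset Printing Implicit Defensive.
Import Order.TTheory GRing.Theory Num.Theory.
Local Open Scope ring_scope.

Section Defs.
Variable R : rcfType.
Local Notation C := (R[i]).
Local Notation cx x := ((x : R)%:C)%C.
Local Notation I := ('i%C : C).

(* vectors (contravariant components) and covariant tensors *)
Definition vec := 'I_4 -> R.
Definition tensor4 := 'I_4 -> 'I_4 -> 'I_4 -> 'I_4 -> R.
Definition ctensor2 := 'I_4 -> 'I_4 -> C.
Definition ctensor4 := 'I_4 -> 'I_4 -> 'I_4 -> 'I_4 -> C.

Definition eta : 'M[R]_4 :=
  \matrix_(i, j) (if i == j then (if i == 0 then 1 else -1) else 0).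

Definition lorentzian (g : 'M[R]_4) : Prop :=
  g^T = g /\ exists P : 'M[R]_4, P^T *m g *m P = eta.

Definition gdot (g : 'M[R]_4) (s t : vec) : R :=
  \sum_(a < 4) \sum_(b < 4) g a b * s a * t b.

Definition lower (g : 'M[R]_4) (t : vec) : 'I_4 -> R :=
  fun a => \sum_(b < 4) g a b * t b.

Definition ginv (g : 'M[R]_4) : 'M[R]_4 := invmx g.

(* time orientation given by a timelike vector tau: t is a future-pointing
   unit timelike vector iff g(t,t) = 1 and g(t,tau) > 0 *)
Definition future_unit (g : 'M[R]_4) (tau t : vec) : Prop :=
  gdot g t t = 1 /\ 0 < gdot g t tau.

Definition perm_symbol (a b c d : 'I_4) : R :=
  let f (i : 'I_4) : R := (nat_of_ord i)%:R in
  ((f b - f a) * (f c - f a) * (f d - f a) * (f c - f b) * (f d - f b)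
     * (f d - f c)) / 12.

(* Levi-Civita volume form eps_{abcd} = sqrt|det g| [abcd]
   (orientation: that of the chosen basis) *)
Definition levi (g : 'M[R]_4) (a b c d : 'I_4) : R :=
  Num.sqrt `|\det g| * perm_symbol a b c d.

Definition dual4 (g : 'M[R]_4) (X : tensor4) : tensor4 :=
  fun a b c d => 2^-1 * \sum_(r < 4) \sum_(s < 4) \sum_(p < 4) \sum_(q < 4)
     levi g a b r s * ginv g r p * ginv g s q * X p q c d.

Definition dual2 (g : 'M[R]_4) (F : 'I_4 -> 'I_4 -> R) : 'I_4 -> 'I_4 -> R :=
  fun a b => 2^-1 * \sum_(r < 4) \sum_(s < 4) \sum_(p < 4) \sum_(q < 4)
     levi g a b r s * ginv g r p * ginv g s q * F p q.

Definition weyl (g : 'M[R]_4) (Cw : tensor4) : Prop :=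
  (forall a b c d, Cw b a c d = - Cw a b c d) /\
  (forall a b c d, Cw a b d c = - Cw a b c d) /\
  (forall a b c d, Cw c d a b = Cw a b c d) /\
  (forall a b c d, Cw a b c d + Cw a c d b + Cw a d b c = 0) /\
  (forall b d, \sum_(a < 4) \sum_(c < 4) ginv g a c * Cw a b c d = 0).

Definition sd4 (g : 'M[R]_4) (Cw : tensor4) : ctensor4 :=
  fun a b c d => 2^-1 * (cx (Cw a b c d) - I * cx (dual4 g Cw a b c d)).

Definition sd2 (g : 'M[R]_4) (F : 'I_4 -> 'I_4 -> R) : ctensor2 :=
  fun a b => 2^-1 * (cx (F a b) - I * cx (dual2 g F a b)).

Definition tetrad_vec (v x y z : vec) (i : 'I_4) : vec :=
  match nat_of_ord i with 0 => v | 1 => x | 2 => y | _ => z end.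

Definition orthonormal_tetrad (g : 'M[R]_4) (v x y z : vec) : Prop :=
  forall i j : 'I_4, gdot g (tetrad_vec v x y z i) (tetrad_vec v x y z j) = eta i j.

Definition wedge (g : 'M[R]_4) (v x : vec) : 'I_4 -> 'I_4 -> R :=
  fun a b => lower g v a * lower g x b - lower g x a * lower g v b.

Definition petrov_canonical_form (g : 'M[R]_4) (Cw : tensor4) (v x y z : vec)
    (s1 s2 s3 : C) : Prop :=
  orthonormal_tetrad g v x y z /\ s1 + s2 + s3 = 0 /\
  forall a b c d, sd4 g Cw a b c d =
      s1 * sd2 g (wedge g v x) a b * sd2 g (wedge g v x) c d
    + s2 * sd2 g (wedge g v y) a b * sd2 g (wedge g v y) c d
    + s3 * sd2 g (wedge g v z) a b * sd2 g (wedge g v z) c d.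

Definition petrov_canonical_tetrad (g : 'M[R]_4) (Cw : tensor4) (v x y z : vec) : Prop :=
  exists s1 s2 s3 : C, petrov_canonical_form g Cw v x y z s1 s2 s3.

(* electric / magnetic parts relative to v, and Q = E + iB in the spatial
   triad (x,y,z) *)
Definition elec (Cw : tensor4) (v : vec) (a b : 'I_4) : R :=
  \sum_(c < 4) \sum_(d < 4) Cw a c d b * v c * v d.

Definition Qmat (g : 'M[R]_4) (Cw : tensor4) (v x y z : vec) : 'M[C]_3 :=
  \matrix_(i < 3, j < 3)
    let X := tetrad_vec v x y z (lift ord0 i) in
    let Y := tetrad_vec v x y z (lift ord0 j) in
    \sum_(a < 4) \sum_(b < 4)
      (cx (elec Cw v a b) + I * cx (elec (dual4 g Cw) v a b))
        * cx (X a) * cx (Y b).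

Definition petrov_typeI (g : 'M[R]_4) (Cw : tensor4) : Prop :=
  exists v x y z, orthonormal_tetrad g v x y z /\
  exists l1 l2 l3 : C, [/\ l1 != l2, l1 != l3, l2 != l3 &
    [/\ root (char_poly (Qmat g Cw v x y z)) l1,
        root (char_poly (Qmat g Cw v x y z)) l2 &
        root (char_poly (Qmat g Cw v x y z)) l3]].

Definition bel_robinson (g : 'M[R]_4) (Cw : tensor4) : ctensor4 :=
  fun a b c d => \sum_(p < 4) \sum_(q < 4) \sum_(p' < 4) \sum_(q' < 4)
    cx (ginv g p p') * cx (ginv g q q') * sd4 g Cw p' a b q'
      * (sd4 g Cw p c d q)^*.

Definition br_quartic (g : 'M[R]_4) (Cw : tensor4) (t : vec) : C :=
  \sum_(a < 4) \sum_(b < 4) \sum_(c < 4) \sum_(d < 4)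
    bel_robinson g Cw a b c d * cx (t a) * cx (t b) * cx (t c) * cx (t d).

Definition br_aligned (g : 'M[R]_4) (Cw : tensor4) (u : vec) : Prop :=
  let W b := \sum_(c < 4) \sum_(d < 4) \sum_(e < 4)
               bel_robinson g Cw b c d e * cx (u c) * cx (u d) * cx (u e) in
  forall a b, cx (lower g u a) * W b - cx (lower g u b) * W a = 0.

Definition petrov_value (s1 s2 s3 : C) : C :=
  16^-1 * (`|s1| ^+ 2 + `|s2| ^+ 2 + `|s3| ^+ 2).

End Defs.

(* Main.v *)
(* In a canonical Petrov tetrad with timelike leg v, C^+ = sum_k s_k F^k F^k, so
   T(a, b, c, d) = sum_kl s_k conj(s_l) M^kl(a, c) M^kl(b, d) with M^kl the
   Hermitian pairing of F^k and F^l. For a unit timelike u, both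
   16 T(u, u, u, u) - sum_k |s_k|^2 and the radial derivative of the quartic form
   from v to u are Hermitian forms in the differences s_i - s_j, with coefficients
   polynomial in the components of u. Both are positive when the s_k are
   distinct and u <> v: hence v is the strict minimum, and the only critical
   point. Since u_[a T_b]cde u^c u^d u^e = 0 is the criticality condition, an
   aligned u equals v; that v is aligned is read off in the tetrad.
   A canonical tetrad exists because E + i B is complex symmetric with distinct
   eigenvalues, hence diagonalised by a complex orthogonal matrix, and such a
   matrix comes from a change of orthonormal tetrad. *)
Require Import Defs.
From HB Require Import structures.
From mathcomp Require Import all_boot all_order all_algebra.
From mathcomp Require Import complex ring lra.
From Stdlib Require Import FunctionalExtensionality.
Import Order.TTheory GRing.Theory Num.Theory.
Local Open Scope ring_scope.
Set Implicit Arguments. Unset Strict Implicit. Unset Printing Implicit Defensive.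

(** * Positivity of Hermitian forms *)

(** The ground field is an arbitrary real closed field, so no compactness argument or calculus
    supplies a minimiser; everything is reduced to explicit polynomial identities. Because s1 + s2 +
    s3 = 0, the two differences x = s2 - s3 and y = s3 - s1 carry all the data: each form is a
    binary Hermitian form, and its positivity rests on one determinant. Once t^2 is replaced by 1 +
    n1^2 + n2^2 + n3^2, these determinants are, up to a factor t^2, polynomials in the n_i^2 with
    nonnegative coefficients. Uniqueness of the timelike leg is a by-product: every canonical leg is
    aligned, and every aligned future unit vector equals one fixed canonical leg. Frames are not
    assumed oriented, so a sign o is carried along inside J = i o. Existence meets two obstacles. An
    eigenvector of a complex symmetric matrix may be isotropic, hence impossible to normalise;
    distinct eigenvalues exclude this. And a complex orthogonal matrix has to be read as a boost and
    a rotation, whose velocity must be shown to have length below 1. *)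

Section HermitianForm.
Context {C : numClosedFieldType}.
Implicit Types A B P Q J x y : C.

Lemma conj_fixed_sqr_ge0 z : z^* = z -> 0 <= z ^+ 2 :> C.
Proof. by move=> hz; rewrite expr2 -{2}hz mul_conjC_ge0. Qed.

(* The Hermitian form of the matrix [[A, P + J Q], [P - J Q, B]], where J = i or
   J = - i; it is positive definite when A, B >= 0 and P^2 + Q^2 < A B. *)
Definition hform A B P Q J x y : C :=
  A * (x * x^*) + B * (y * y^*) + P * (x * y^* + y * x^*)
  + J * Q * (x * y^* - y * x^*).

Lemma hform_square A B P Q J x y :
  A^* = A -> P^* = P -> Q^* = Q -> J ^+ 2 = -1 -> J^* = - J ->
  A * hform A B P Q J x y
  = (A * x + (P - J * Q) * y) * (A * x + (P - J * Q) * y)^*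
    + (A * B - P ^+ 2 - Q ^+ 2) * (y * y^*).
Proof.
move=> hA hP hQ hJ hJc; rewrite /hform.
rewrite !(rmorphD, rmorphN, rmorphM) /= hA hP hQ hJc.
ring: hJ.
Qed.

Lemma hform_ge0 A B P Q J x y :
  0 <= A -> 0 <= B -> P^* = P -> Q^* = Q -> J ^+ 2 = -1 -> J^* = - J ->
  P ^+ 2 + Q ^+ 2 <= A * B -> 0 <= hform A B P Q J x y.
Proof.
move=> A0 B0 hP hQ hJ hJc hdet.
have [A_eq0|A_neq0] := eqVneq A 0.
  (* With [A] zero the determinant bound forces P = Q = 0, and only the term in [B] remains. *)
  move: hdet; rewrite A_eq0 mul0r => hdet.
  have P20 : P ^+ 2 = 0.
    apply/eqP; rewrite eq_le conj_fixed_sqr_ge0 // andbT (le_trans _ hdet) //.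
    by rewrite lerDl conj_fixed_sqr_ge0.
  have Q20 : Q ^+ 2 = 0.
    by apply/eqP; rewrite eq_le conj_fixed_sqr_ge0 // andbT; move: hdet; rewrite P20 add0r.
  move/eqP: P20; rewrite sqrf_eq0 => /eqP ->.
  move/eqP: Q20; rewrite sqrf_eq0 => /eqP ->.
  by rewrite /hform mulr0 !mul0r !addr0 add0r mulr_ge0 ?mul_conjC_ge0.
have A_gt0 : 0 < A by rewrite lt_def A_neq0.
rewrite -(pmulr_rge0 _ A_gt0) hform_square //; last by rewrite geC0_conj.
by rewrite addr_ge0 ?mul_conjC_ge0 // mulr_ge0 ?mul_conjC_ge0 // -addrA -opprD subr_ge0.
Qed.

Lemma hform_gt0 A B P Q J x y :
  0 <= A -> 0 <= B -> P^* = P -> Q^* = Q -> J ^+ 2 = -1 -> J^* = - J ->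
  P ^+ 2 + Q ^+ 2 < A * B -> x != 0 -> 0 < hform A B P Q J x y.
Proof.
move=> A0 B0 hP hQ hJ hJc hdet x0.
have AB0 : 0 < A * B by rewrite (le_lt_trans _ hdet) // addr_ge0 ?conj_fixed_sqr_ge0.
have A_gt0 : 0 < A.
  by rewrite lt_def A0 andbT; apply: contraTneq AB0 => ->; rewrite mul0r ltxx.
rewrite -(pmulr_rgt0 _ A_gt0) hform_square //; last by rewrite geC0_conj.
have [->|y0] := eqVneq y 0.
  rewrite mulr0 mul0r mulr0 !addr0 mul_conjC_gt0 mulf_neq0 //.
  by rewrite gt_eqF.
rewrite ltr_wpDl ?mul_conjC_ge0 // mulr_gt0 ?mul_conjC_gt0 //.
by rewrite -addrA -opprD subr_gt0.
Qed.

End HermitianForm.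

Ltac nonneg := repeat first
  [ done | exact: ler01 | exact: ler0n
  | apply: addr_ge0 | apply: mulr_ge0 | apply: exprn_ge0 ].

(** * Positivity of the energy gap and of the radial slope *)

Section GapForms.
Context {C : numClosedFieldType}.
Implicit Types J t n x y : C.

(* A timelike vector (t, n1, n2, n3) in the canonical tetrad has
   16 T(t, t, t, t) - sum_k |s_k|^2 = 4 energy_gap, with x = s2 - s3 and
   y = s3 - s1, hence x + y = s2 - s1 is the third difference. *)
Definition energy_gap J t n1 n2 n3 x y : C :=
  let p1 := n1 ^+ 2 in let p2 := n2 ^+ 2 in let p3 := n3 ^+ 2 in
  hform ((p1 + p3) * (1 + (p1 + p3))) ((p2 + p3) * (1 + (p2 + p3)))
    (p3 * t ^+ 2 - p1 * p2) (2 * t * n1 * n2 * n3) J x y.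

(* Equals 8 t (t T(u, u, u, u) - T(v, u, u, u)) for u = (t, n1, n2, n3) and the
   timelike leg v: up to a positive factor, the derivative of the quartic form
   along the geodesic of the hyperboloid from v to u. *)
Definition radial_slope J t n1 n2 n3 x y : C :=
  let p1 := n1 ^+ 2 in let p2 := n2 ^+ 2 in let p3 := n3 ^+ 2 in
  hform (t ^+ 2 * ((p1 + p3) + 2 * (p1 + p3) ^+ 2))
    (t ^+ 2 * ((p2 + p3) + 2 * (p2 + p3) ^+ 2))
    (t ^+ 2 * (p3 + 2 * ((p1 + p3) * (p2 + p3) - 2 * (p1 * p2))))
    (t * n1 * n2 * n3 * (4 * (p1 + p2 + p3) + 3)) J x y.

Lemma conj_fixed_sqr_gt0 z : z^* = z -> z != 0 -> 0 < z ^+ 2 :> C.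
Proof. by move=> hz z0; rewrite lt_def sqrf_eq0 z0 conj_fixed_sqr_ge0. Qed.

Section Positivity.
Variables (J t n1 n2 n3 x y : C).
Hypotheses (hJ : J ^+ 2 = -1) (hJc : J^* = - J).
Hypotheses (ht : t^* = t) (h1 : n1^* = n1) (h2 : n2^* = n2) (h3 : n3^* = n3).
Hypothesis hyp : t ^+ 2 = 1 + (n1 ^+ 2 + n2 ^+ 2 + n3 ^+ 2).

Let p1 := n1 ^+ 2.
Let p2 := n2 ^+ 2.
Let p3 := n3 ^+ 2.
Let p1_ge0 : 0 <= p1. Proof. exact: conj_fixed_sqr_ge0. Qed.
Let p2_ge0 : 0 <= p2. Proof. exact: conj_fixed_sqr_ge0. Qed.
Let p3_ge0 : 0 <= p3. Proof. exact: conj_fixed_sqr_ge0. Qed.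
(* When e2 = 0 the Hermitian determinants may vanish, but then u lies in the
   plane of v and one axis, and only one difference s_i - s_j is left. *)
Let e2 := p3 * (p1 + p2) + p1 * p2.
Let e2_ge0 : 0 <= e2.
Proof. by nonneg. Qed.

Let t2_gt0 : 0 < t ^+ 2.
Proof. by rewrite hyp ltr_pwDl ?ltr01 // !addr_ge0. Qed.

(** Put a = p1 + p3 and b = p2 + p3. The subtracted sum of squares is (p3 t^2 + p1 p2)^2, and p3 t^2
    + p1 p2 = p3 + a b. The determinant collapses to a b - p3^2 + a b (p1 + p2), where a b = e2 +
    p3^2. *)
Let energy_det : exists2 r, 0 <= r &
  (p1 + p3) * (1 + (p1 + p3)) * ((p2 + p3) * (1 + (p2 + p3)))
  - ((p3 * t ^+ 2 - p1 * p2) ^+ 2 + (2 * t * n1 * n2 * n3) ^+ 2) = e2 + r.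
Proof.
exists (p3 ^+ 2 * (p1 + p2) + e2 * (p1 + p2)).
  by nonneg.
have -> : (2 * t * n1 * n2 * n3) ^+ 2 = 4 * t ^+ 2 * p1 * p2 * p3.
  by rewrite /p1 /p2 /p3; ring.
by rewrite /e2 hyp -/p1 -/p2 -/p3; ring.
Qed.

(** The last square contains a single t^2, hence the outer factor. With s = p1 + p2 + p3, the
    coefficients 8 (1 + s) (1 + 2 s) and (4 s + 3)^2 of p1 p2 p3 cancel up to 1. What is left is (1
    + s) (e2 + 2 (p1 + p3) (p2 + p3) (p1 + p2)) - p1 p2 p3, and s e2 contains 3 p1 p2 p3. *)
Let slope_det : exists2 r, 0 <= r &
  t ^+ 2 * ((p1 + p3) + 2 * (p1 + p3) ^+ 2)
  * (t ^+ 2 * ((p2 + p3) + 2 * (p2 + p3) ^+ 2))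
  - ((t ^+ 2 * (p3 + 2 * ((p1 + p3) * (p2 + p3) - 2 * (p1 * p2)))) ^+ 2
     + (t * n1 * n2 * n3 * (4 * (p1 + p2 + p3) + 3)) ^+ 2)
  = t ^+ 2 * (e2 + r).
Proof.
exists ((p1 + p2) * (p1 * p2) + (p1 + p3) * (p1 * p3) + (p2 + p3) * (p2 * p3)
   + 2 * (p1 * p2 * p3)
   + (1 + (p1 + p2 + p3)) * (2 * ((p1 + p3) * (p2 + p3)) * (p1 + p2))).
  by nonneg.
have -> : (t * n1 * n2 * n3 * (4 * (p1 + p2 + p3) + 3)) ^+ 2
   = t ^+ 2 * p1 * p2 * p3 * (4 * (p1 + p2 + p3) + 3) ^+ 2.
  by rewrite /p1 /p2 /p3; ring.
by rewrite /e2 hyp -/p1 -/p2 -/p3; ring.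
Qed.

Let conjK := (rmorphD, rmorphN, rmorphM, rmorphXn, ht, h1, h2, h3,
              conjC_nat, conjC1).

Lemma energy_gap_ge0 : 0 <= energy_gap J t n1 n2 n3 x y.
Proof.
have [r r0 hr] := energy_det.
apply: hform_ge0 => //; rewrite ?(conjK) /= ?(conjK) //.
- by nonneg.
- by nonneg.
by rewrite -subr_ge0 -/p1 -/p2 -/p3 hr addr_ge0.
Qed.

Hypotheses (x0 : x != 0) (y0 : y != 0) (xy0 : x + y != 0).
Hypothesis n_neq0 : [|| n1 != 0, n2 != 0 | n3 != 0].

Let e2_cases : [\/ 0 < e2, [/\ n1 != 0, n2 = 0 & n3 = 0],
  [/\ n2 != 0, n1 = 0 & n3 = 0] | [/\ n3 != 0, n1 = 0 & n2 = 0]].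
Proof.
have [e20|e20] := eqVneq e2 0; last by constructor 1; rewrite lt_def e20.
have e2E : e2 = p3 * p1 + p3 * p2 + p1 * p2 by rewrite /e2 mulrDr.
have q1 : 0 <= p3 * p1 by nonneg.
have q2 : 0 <= p3 * p2 by nonneg.
have q3 : 0 <= p1 * p2 by nonneg.
move/eqP: e20; rewrite e2E (paddr_eq0 (addr_ge0 q1 q2) q3) (paddr_eq0 q1 q2).
rewrite !mulf_eq0 ?orbb.
case/andP=> /andP[].
have [a|a] := eqVneq n1 0; have [b|b] := eqVneq n2 0;
  have [c|c] := eqVneq n3 0 => //= _ _ _.
- by move: n_neq0; rewrite a b c eqxx.
- by constructor 4.
- by constructor 3.
by constructor 2.
Qed.

Lemma energy_gap_gt0 : 0 < energy_gap J t n1 n2 n3 x y.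
Proof.
have [e20|[a b c]|[b a c]|[c a b]] := e2_cases.
- have [r r0 hr] := energy_det.
  apply: hform_gt0 => //; rewrite ?(conjK) /= ?(conjK) //.
  + by nonneg.
  + by nonneg.
  by rewrite -subr_gt0 -/p1 -/p2 -/p3 hr ltr_pwDl.
- have -> : energy_gap J t n1 n2 n3 x y = p1 * (1 + p1) * (x * x^*).
    by rewrite /energy_gap /hform /p1 b c; ring.
  have p_gt0 : 0 < p1 by exact: conj_fixed_sqr_gt0.
  apply: mulr_gt0; last by rewrite mul_conjC_gt0.
  by apply: mulr_gt0 => //; apply: ltr_pwDl; rewrite ?ltr01 // ltW.
- have -> : energy_gap J t n1 n2 n3 x y = p2 * (1 + p2) * (y * y^*).
    by rewrite /energy_gap /hform /p2 a c; ring.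
  have p_gt0 : 0 < p2 by exact: conj_fixed_sqr_gt0.
  apply: mulr_gt0; last by rewrite mul_conjC_gt0.
  by apply: mulr_gt0 => //; apply: ltr_pwDl; rewrite ?ltr01 // ltW.
(* On the third axis t^2 = 1 + p3 makes all three remaining coefficients equal: the form has rank
   one and sees only [x + y], which is why the third difference must be nonzero too. *)
have -> : energy_gap J t n1 n2 n3 x y = p3 * (1 + p3) * ((x + y) * (x + y)^*).
  by rewrite /energy_gap /hform hyp /p3 a b rmorphD /=; ring.
have p_gt0 : 0 < p3 by exact: conj_fixed_sqr_gt0.
apply: mulr_gt0; last by rewrite mul_conjC_gt0.
by apply: mulr_gt0 => //; apply: ltr_pwDl; rewrite ?ltr01 // ltW.
Qed.

Lemma radial_slope_gt0 : 0 < radial_slope J t n1 n2 n3 x y.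
Proof.
have [e20|[a b c]|[b a c]|[c a b]] := e2_cases.
- have [r r0 hr] := slope_det.
  apply: hform_gt0 => //; rewrite ?(conjK) /= ?(conjK) //.
  + by have t2_ge0 := ltW t2_gt0; nonneg.
  + by have t2_ge0 := ltW t2_gt0; nonneg.
  by rewrite -subr_gt0 -/p1 -/p2 -/p3 hr mulr_gt0 // ltr_pwDl.
- have -> : radial_slope J t n1 n2 n3 x y
    = t ^+ 2 * (p1 * (1 + 2 * p1)) * (x * x^*).
    by rewrite /radial_slope /hform /p1 b c; ring.
  have p_gt0 : 0 < p1 by exact: conj_fixed_sqr_gt0.
  apply: mulr_gt0; last by rewrite mul_conjC_gt0.
  apply: mulr_gt0 => //; apply: mulr_gt0 => //.
  by apply: ltr_pwDl; [exact: ltr01 | nonneg].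
- have -> : radial_slope J t n1 n2 n3 x y
    = t ^+ 2 * (p2 * (1 + 2 * p2)) * (y * y^*).
    by rewrite /radial_slope /hform /p2 a c; ring.
  have p_gt0 : 0 < p2 by exact: conj_fixed_sqr_gt0.
  apply: mulr_gt0; last by rewrite mul_conjC_gt0.
  apply: mulr_gt0 => //; apply: mulr_gt0 => //.
  by apply: ltr_pwDl; [exact: ltr01 | nonneg].
have -> : radial_slope J t n1 n2 n3 x y
  = t ^+ 2 * (p3 * (1 + 2 * p3)) * ((x + y) * (x + y)^*).
  by rewrite /radial_slope /hform /p3 a b rmorphD /=; ring.
have p_gt0 : 0 < p3 by exact: conj_fixed_sqr_gt0.
apply: mulr_gt0; last by rewrite mul_conjC_gt0.
apply: mulr_gt0 => //; apply: mulr_gt0 => //.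
by apply: ltr_pwDl; [exact: ltr01 | nonneg].
Qed.

End Positivity.
End GapForms.

(** * Orthonormal frames *)

Local Notation cx x := ((x%R)%:C)%C.

Definition i0 : 'I_4 := @Ordinal 4 0 isT.
Definition i1 : 'I_4 := @Ordinal 4 1 isT.
Definition i2 : 'I_4 := @Ordinal 4 2 isT.
Definition i3 : 'I_4 := @Ordinal 4 3 isT.

Lemma ord4_ind (P : 'I_4 -> Prop) : P i0 -> P i1 -> P i2 -> P i3 -> forall i, P i.
Proof.
move=> h0 h1 h2 h3 [[|[|[|[|//]]]] hi].
- by rewrite (_ : Ordinal hi = i0) //; apply: val_inj.
- by rewrite (_ : Ordinal hi = i1) //; apply: val_inj.
- by rewrite (_ : Ordinal hi = i2) //; apply: val_inj.
- by rewrite (_ : Ordinal hi = i3) //; apply: val_inj.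
Qed.

Lemma sum4 (V : nmodType) (F : 'I_4 -> V) :
  \sum_(i < 4) F i = F i0 + F i1 + F i2 + F i3.
Proof.
rewrite !big_ord_recl big_ord0 addr0 !addrA.
by congr (_ + _ + _ + _); congr F; apply: val_inj.
Qed.

Definition j1 : 'I_3 := @Ordinal 3 0 isT.
Definition j2 : 'I_3 := @Ordinal 3 1 isT.
Definition j3 : 'I_3 := @Ordinal 3 2 isT.

Lemma ord3_ind (P : 'I_3 -> Prop) : P j1 -> P j2 -> P j3 -> forall i, P i.
Proof.
move=> h1 h2 h3 [[|[|[|//]]] hi].
- by rewrite (_ : Ordinal hi = j1) //; apply: val_inj.
- by rewrite (_ : Ordinal hi = j2) //; apply: val_inj.
- by rewrite (_ : Ordinal hi = j3) //; apply: val_inj.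
Qed.

Lemma sum3 (V : nmodType) (F : 'I_3 -> V) :
  \sum_(i < 3) F i = F j1 + F j2 + F j3.
Proof.
rewrite !big_ord_recl big_ord0 addr0 !addrA.
by congr (_ + _ + _); congr F; apply: val_inj.
Qed.

Lemma liftE : (lift ord0 j1 = i1) * (lift ord0 j2 = i2) * (lift ord0 j3 = i3).
Proof. by split; [split|]; apply: val_inj. Qed.

Section Signature.
Variable R : rcfType.
Definition sgn (i : 'I_4) : R := Defs.eta R i i.

Lemma etaE i j : Defs.eta R i j = if i == j then sgn i else 0.
Proof. by rewrite /sgn !mxE eqxx. Qed.

Lemma sgnE : (sgn i0 = 1) * (sgn i1 = -1) * (sgn i2 = -1) * (sgn i3 = -1).
Proof. by rewrite /sgn !mxE. Qed.

Lemma sgn_sqr i : sgn i * sgn i = 1.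
Proof. by elim/ord4_ind: i; rewrite sgnE ?mulrNN mulr1. Qed.
End Signature.
Arguments sgn {R}.

Section Frame.
Variable R : rcfType.
Local Notation C := (R[i]).
Implicit Types (g : 'M[R]_4) (s t u : vec R) (X Y : ctensor2 R).

Definition orthonormal_frame g (e : 'I_4 -> vec R) :=
  forall i j, gdot g (e i) (e j) = Defs.eta R i j.

Definition ev1 (A : 'I_4 -> C) s : C := \sum_(a < 4) A a * cx (s a).
Definition ev2 X s t : C := \sum_(a < 4) \sum_(b < 4) X a b * cx (s a) * cx (t b).

Lemma ev2E X s t : ev2 X s t = ev1 (fun a => ev1 (X a) t) s.
Proof.
apply: eq_bigr => a _; rewrite mulr_suml; apply: eq_bigr => b _.
by rewrite mulrAC.
Qed.

Section OneFrame.
Variables (g : 'M[R]_4) (e : 'I_4 -> vec R).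
Hypothesis onb : orthonormal_frame g e.

Let E : 'M[R]_4 := \matrix_(a, i) e i a.

Let EgE : E^T *m g *m E = Defs.eta R.
Proof.
apply/matrixP=> i j; rewrite -onb !mxE /gdot exchange_big.
apply: eq_bigr => b _; rewrite !mxE mulr_suml; apply: eq_bigr => a _.
by rewrite !mxE (mulrC (e i a)).
Qed.

Let eta2 : Defs.eta R *m Defs.eta R = 1%:M.
Proof.
apply/matrixP=> i j; rewrite mxE sum4 !mxE.
by elim/ord4_ind: i; elim/ord4_ind: j; rewrite /=; ring.
Qed.

Let Einv : E *m (Defs.eta R *m E^T *m g) = 1%:M.
Proof. by apply: mulmx1C; rewrite -!mulmxA (mulmxA E^T) EgE eta2. Qed.

(** From E^T g E = eta and eta^2 = 1, the matrix E eta E^T is a one-sided, hence two-sided, inverse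
    of g; invertibility of g thus comes from the frame itself. *)
Lemma ginv_frame p q : ginv g p q = \sum_(i < 4) sgn i * e i p * e i q.
Proof.
have gV : E *m Defs.eta R *m E^T *m g = 1%:M by rewrite -!mulmxA -[RHS]Einv !mulmxA.
have gU : g \in unitmx by case: (mulmx1_unit gV).
have -> : ginv g = E *m Defs.eta R *m E^T.
  by rewrite -[RHS](mulmxK gU) gV mul1mx.
rewrite mxE; apply: eq_bigr => i _; rewrite !mxE (bigD1 i) //= big1 ?addr0.
  by rewrite etaE eqxx !mxE (mulrC (sgn i)).
by move=> j ij; rewrite etaE (negbTE ij) mulr0.
Qed.

Lemma frame_expand t p : t p = \sum_(i < 4) sgn i * gdot g (e i) t * e i p.
Proof.
have h : \col_q t q = E *m (Defs.eta R *m E^T *m g *m \col_q t q).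
  by rewrite mulmxA Einv mul1mx.
have /(congr1 (fun M : 'cV[R]_4 => M p 0)) /= := h; rewrite mxE => ->; rewrite mxE.
apply: eq_bigr => i _; rewrite [E p i]mxE mulrC; congr (_ * _).
rewrite -!mulmxA mxE (bigD1 i) //= big1 ?addr0; last first.
  by move=> j ij; rewrite etaE eq_sym (negbTE ij) mul0r.
rewrite etaE eqxx; congr (_ * _); rewrite mulmxA mxE /gdot exchange_big.
apply: eq_bigr => b _; rewrite !mxE mulr_suml; apply: eq_bigr => a _.
by rewrite !mxE (mulrC (e i a)).
Qed.

Lemma ev1_frame A t :
  ev1 A t = \sum_(i < 4) cx (sgn i * gdot g (e i) t) * ev1 A (e i).
Proof.
rewrite /ev1 (eq_bigr (fun a => \sum_(i < 4)
  cx (sgn i * gdot g (e i) t) * (A a * cx (e i a)))); last first.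
  move=> a _; rewrite (frame_expand t a) raddf_sum mulr_sumr; apply: eq_bigr => i _.
  by rewrite /=; ring.
by rewrite exchange_big; apply: eq_bigr => i _; rewrite -mulr_sumr.
Qed.

Lemma ev1_ext A B : (forall i, ev1 A (e i) = ev1 B (e i)) -> A =1 B.
Proof.
move=> AB a; pose d : vec R := fun b => (b == a)%:R.
have ev1d D : ev1 D d = D a.
  rewrite /ev1 (bigD1 a) //= big1 ?addr0 /d ?eqxx ?mulr1 // => b /negbTE ->.
  by rewrite mulr0.
rewrite -(ev1d A) -(ev1d B) !ev1_frame; apply: eq_bigr => i _; by rewrite AB.
Qed.

Lemma ev2_ext X Y :
  (forall i j, ev2 X (e i) (e j) = ev2 Y (e i) (e j)) -> forall a b, X a b = Y a b.
Proof.
move=> XY a b; move: b; apply: ev1_ext => j; move: a; apply: ev1_ext => i.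
by rewrite -!ev2E.
Qed.

(** Turns a contraction with the inverse metric into a signed sum over the frame; the dual and
    [hermite2] reach frame components through it. *)
Lemma ginv_contract (A : 'I_4 -> C) r :
  \sum_(p < 4) cx (ginv g r p) * A p
  = \sum_(k < 4) cx (sgn k) * cx (e k r) * ev1 A (e k).
Proof.
rewrite (eq_bigr (fun p => \sum_(k < 4)
   cx (sgn k) * cx (e k r) * (A p * cx (e k p)))); last first.
  move=> p _; rewrite ginv_frame raddf_sum mulr_suml; apply: eq_bigr => k _.
  by rewrite /=; ring.
by rewrite exchange_big; apply: eq_bigr => i _; rewrite -mulr_sumr.
Qed.

End OneFrame.
End Frame.

(** * The volume form in a frame *)

Section Alternating.
Variable R : rcfType.

Lemma perm_symbol_swap12 i j k l : perm_symbol R j i k l = - perm_symbol R i j k l.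
Proof. by rewrite /perm_symbol; ring. Qed.
Lemma perm_symbol_swap23 i j k l : perm_symbol R i k j l = - perm_symbol R i j k l.
Proof. by rewrite /perm_symbol; ring. Qed.
Lemma perm_symbol_swap34 i j k l : perm_symbol R i j l k = - perm_symbol R i j k l.
Proof. by rewrite /perm_symbol; ring. Qed.

Lemma alternating4 (f : 'I_4 -> 'I_4 -> 'I_4 -> 'I_4 -> R) :
  (forall i j k l, f j i k l = - f i j k l) ->
  (forall i j k l, f i k j l = - f i j k l) ->
  (forall i j k l, f i j l k = - f i j k l) ->
  forall i j k l, f i j k l = f i0 i1 i2 i3 * perm_symbol R i j k l.
Proof.
move=> s12 s23 s34.
have oppr_eq x : x = - x -> x = 0 :> R by move=> h; lra.
have e12 i k l : f i i k l = 0 by apply: oppr_eq; apply: s12.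
have e23 i k l : f k i i l = 0 by apply: oppr_eq; apply: s23.
have e34 i k l : f k l i i = 0 by apply: oppr_eq; apply: s34.
(* Only instances that undo an adjacent inversion are listed, so rewriting with them is a bubble
   sort and terminates; repeated indices become adjacent and give 0. *)
have sort12 := (s12 i0 i1, s12 i0 i2, s12 i0 i3, s12 i1 i2, s12 i1 i3, s12 i2 i3).
have sort23 := ((s23 ^~ i0) ^~ i1, (s23 ^~ i0) ^~ i2, (s23 ^~ i0) ^~ i3,
                (s23 ^~ i1) ^~ i2, (s23 ^~ i1) ^~ i3, (s23 ^~ i2) ^~ i3).
have sort34 i j := (s34 i j i0 i1, s34 i j i0 i2, s34 i j i0 i3,
                (s34 i j i1 i2), (s34 i j i1 i3), (s34 i j i2 i3)).
move=> i j k l.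
elim/ord4_ind: i; elim/ord4_ind: j; elim/ord4_ind: k; elim/ord4_ind: l;
  do ?[rewrite e12 | rewrite e23 | rewrite e34 | rewrite sort12 | rewrite sort23 | rewrite sort34];
  rewrite /perm_symbol /i0 /i1 /i2 /i3 /=; by field.
Qed.
End Alternating.

Section Determinant.
Variable R : rcfType.

Lemma det3E (A : 'M[R]_3) : \det A =
    A j1 j1 * (A j2 j2 * A j3 j3 - A j2 j3 * A j3 j2)
  - A j1 j2 * (A j2 j1 * A j3 j3 - A j2 j3 * A j3 j1)
  + A j1 j3 * (A j2 j1 * A j3 j2 - A j2 j2 * A j3 j1).
Proof.
(* Reading entries through natural numbers identifies the differently built ordinals that the
   cofactor expansion produces, so that [ring] sees equal atoms. *)
pose a (i j : nat) := A (inord i) (inord j).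
have aE i j : A i j = a i j by rewrite /a !inord_val.
rewrite !(expand_det_row _ ord0) /cofactor !big_ord_recl !big_ord0.
rewrite !(expand_det_row _ ord0) /cofactor !big_ord_recl !big_ord0 !det_mx11.
rewrite !mxE !aE /= /bump /=; ring.
Qed.

Lemma sum_perm_symbol (F : 'I_4 -> 'I_4 -> 'I_4 -> 'I_4 -> R) :
  \sum_(a < 4) \sum_(b < 4) \sum_(c < 4) \sum_(d < 4)
    perm_symbol R a b c d * F a b c d =
    F i0 i1 i2 i3 - F i0 i1 i3 i2 - F i0 i2 i1 i3 + F i0 i2 i3 i1
    + F i0 i3 i1 i2 - F i0 i3 i2 i1 - F i1 i0 i2 i3 + F i1 i0 i3 i2
    + F i1 i2 i0 i3 - F i1 i2 i3 i0 - F i1 i3 i0 i2 + F i1 i3 i2 i0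
    + F i2 i0 i1 i3 - F i2 i0 i3 i1 - F i2 i1 i0 i3 + F i2 i1 i3 i0
    + F i2 i3 i0 i1 - F i2 i3 i1 i0 - F i3 i0 i1 i2 + F i3 i0 i2 i1
    + F i3 i1 i0 i2 - F i3 i1 i2 i0 - F i3 i2 i0 i1 + F i3 i2 i1 i0.
Proof.
have e12 i k l : perm_symbol R i i k l = 0 by rewrite /perm_symbol; ring.
have e13 i k l : perm_symbol R i k i l = 0 by rewrite /perm_symbol; ring.
have e14 i k l : perm_symbol R i k l i = 0 by rewrite /perm_symbol; ring.
have e23 i k l : perm_symbol R k i i l = 0 by rewrite /perm_symbol; ring.
have e24 i k l : perm_symbol R k i l i = 0 by rewrite /perm_symbol; ring.
have e34 i k l : perm_symbol R k l i i = 0 by rewrite /perm_symbol; ring.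
rewrite !sum4 !(e12, e13, e14, e23, e24, e34) !(mul0r, add0r, addr0).
rewrite /perm_symbol /=; by field.
Qed.

Lemma det4_perm_symbol (A : 'M[R]_4) :
  \det A = \sum_(a < 4) \sum_(b < 4) \sum_(c < 4) \sum_(d < 4)
    perm_symbol R a b c d * (A i0 a * A i1 b * A i2 c * A i3 d).
Proof.
rewrite sum_perm_symbol.
pose m (i j : nat) := A (inord i) (inord j).
have aE i j : A i j = m i j by rewrite /m !inord_val.
rewrite (expand_det_row _ ord0) /cofactor !big_ord_recl !big_ord0 !det3E.
rewrite !mxE !aE /= /bump /=; ring.
Qed.

End Determinant.

(** * The complexified Hodge dual in a frame *)

Section Dual.
Variable R : rcfType.
Local Notation C := (R[i]).
Implicit Types (g : 'M[R]_4) (s t u v : vec R) (X Y : ctensor2 R).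

Definition levi4 g s t u v : R :=
  \sum_(a < 4) \sum_(b < 4) \sum_(c < 4) \sum_(d < 4)
    levi g a b c d * (s a * t b * u c * v d).

Lemma eq_sum4 (F G : 'I_4 -> 'I_4 -> 'I_4 -> 'I_4 -> R) :
  (forall a b c d, F a b c d = G a b c d) ->
  \sum_a \sum_b \sum_c \sum_d F a b c d = \sum_a \sum_b \sum_c \sum_d G a b c d.
Proof.
by move=> FG; do 4!apply: eq_bigr => ? _.
Qed.

Lemma sum4N (F : 'I_4 -> 'I_4 -> 'I_4 -> 'I_4 -> R) :
  \sum_a \sum_b \sum_c \sum_d (- F a b c d) = - \sum_a \sum_b \sum_c \sum_d F a b c d.
Proof.
by do 4!(rewrite -sumrN; apply: eq_bigr => ? _).
Qed.

Lemma levi4_swap12 g s t u v : levi4 g t s u v = - levi4 g s t u v.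
Proof.
rewrite /levi4 exchange_big -sum4N; apply: eq_sum4 => a b c d.
by rewrite /levi perm_symbol_swap12; ring.
Qed.

Lemma levi4_swap23 g s t u v : levi4 g s u t v = - levi4 g s t u v.
Proof.
rewrite /levi4 -sum4N; apply: eq_bigr => a _; rewrite exchange_big.
do 3!apply: eq_bigr => ? _.
by rewrite /levi perm_symbol_swap23; ring.
Qed.

Lemma levi4_swap34 g s t u v : levi4 g s t v u = - levi4 g s t u v.
Proof.
rewrite /levi4 -sum4N; do 2!apply: eq_bigr => ? _; rewrite exchange_big.
do 2!apply: eq_bigr => ? _.
by rewrite /levi perm_symbol_swap34; ring.
Qed.

(** Complex-linear extension of [dual2], which is defined on real forms only and cannot state
    self-duality. *)
Definition cdual g X : ctensor2 R := fun a b =>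
  2^-1 * \sum_(r < 4) \sum_(s < 4) \sum_(p < 4) \sum_(q < 4)
     cx (levi g a b r s * ginv g r p * ginv g s q) * X p q.

Section OneFrame.
Variables (g : 'M[R]_4) (e : 'I_4 -> vec R).
Hypothesis onb : orthonormal_frame g e.

Definition orientation : R := levi4 g (e i0) (e i1) (e i2) (e i3).

Lemma levi4_frame i j k l :
  levi4 g (e i) (e j) (e k) (e l) = orientation * perm_symbol R i j k l.
Proof.
apply: (@alternating4 R (fun i j k l => levi4 g (e i) (e j) (e k) (e l))) => *.
- exact: levi4_swap12.
- exact: levi4_swap23.
- exact: levi4_swap34.
Qed.

(** With E the matrix of the frame, det g (det E)^2 = det eta = -1, while the orientation is sqrt
    |det g| det E. *)
Lemma orientation_sqr : orientation ^+ 2 = 1.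
Proof.
pose E : 'M[R]_4 := \matrix_(i, a) e i a.
have EgE : E *m g *m E^T = Defs.eta R.
  apply/matrixP=> i j; rewrite -onb !mxE /gdot exchange_big.
  apply: eq_bigr => b _; rewrite !mxE mulr_suml; apply: eq_bigr => a _.
  by rewrite !mxE (mulrC (e i a)).
have det_eta : \det (Defs.eta R) = -1.
  rewrite det4_perm_symbol sum_perm_symbol !mxE /i0 /i1 /i2 /i3 /=.
  by ring.
have detg : \det g * \det E ^+ 2 = -1.
  by rewrite -det_eta -EgE !det_mulmx det_tr; ring.
have -> : orientation = Num.sqrt `|\det g| * \det E.
  rewrite (det4_perm_symbol E) /orientation /levi4.
  do 4!(rewrite mulr_sumr; apply: eq_bigr => ? _).
  by rewrite !mxE /levi; ring.
rewrite exprMn sqr_sqrtr // ler0_norm; first by rewrite mulNr detg opprK.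
rewrite leNgt; apply/negP => gpos.
have : 0 <= \det g * \det E ^+ 2 by rewrite mulr_ge0 ?sqr_ge0 // ltW.
by rewrite detg oppr_ge0 ler10.
Qed.

Lemma cdual_frame X i j :
  ev2 (cdual g X) (e i) (e j)
  = 2^-1 * \sum_(k < 4) \sum_(l < 4)
      cx (sgn k * sgn l * (orientation * perm_symbol R i j k l)) * ev2 X (e k) (e l).
Proof.
have cdualE a b : cdual g X a b = 2^-1 * \sum_(k < 4) \sum_(l < 4)
    \sum_(r < 4) \sum_(s < 4)
    cx (sgn k * sgn l * (levi g a b r s * e k r * e l s)) * ev2 X (e k) (e l).
  rewrite /cdual; congr (_ * _).
  under [RHS]eq_bigr do rewrite exchange_big /=.
  rewrite [RHS]exchange_big; apply: eq_bigr => r _ /=.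
  under [RHS]eq_bigr do rewrite exchange_big /=.
  rewrite [RHS]exchange_big; apply: eq_bigr => s _ /=.
  transitivity (cx (levi g a b r s) * \sum_(p < 4) cx (ginv g r p) *
     \sum_(q < 4) cx (ginv g s q) * X p q).
    rewrite mulr_sumr; apply: eq_bigr => p _; rewrite !mulr_sumr.
    by apply: eq_bigr => q _; ring.
  rewrite (eq_bigr (fun p => cx (ginv g r p) *
    \sum_(l < 4) cx (sgn l) * cx (e l s) * ev1 (X p) (e l))); last first.
    by move=> p _; rewrite (ginv_contract onb).
  rewrite (ginv_contract onb) mulr_sumr; apply: eq_bigr => k _.
  have -> : ev1 (fun p => \sum_(l < 4) cx (sgn l) * cx (e l s) * ev1 (X p) (e l)) (e k)
    = \sum_(l < 4) cx (sgn l) * cx (e l s) * ev2 X (e k) (e l).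
    rewrite /ev1; under eq_bigr do rewrite mulr_suml.
    rewrite exchange_big; apply: eq_bigr => l _.
    rewrite ev2E /ev1 mulr_sumr; apply: eq_bigr => p _.
    by rewrite mulrA.
  by rewrite !mulr_sumr; apply: eq_bigr => l _; ring.
transitivity (\sum_(a < 4) \sum_(b < 4) \sum_(k < 4) \sum_(l < 4) \sum_(r < 4) \sum_(s < 4)
   2^-1 * (cx (sgn k * sgn l * (levi g a b r s * (e i a * e j b * e k r * e l s)))
     * ev2 X (e k) (e l))).
  do 2!apply: eq_bigr => ? _; rewrite cdualE -!mulrA mulr_suml mulr_sumr.
  apply: eq_bigr => k _; rewrite !mulr_suml mulr_sumr; apply: eq_bigr => l _.
  rewrite !mulr_suml mulr_sumr; apply: eq_bigr => r _.
  rewrite !mulr_suml mulr_sumr; apply: eq_bigr => s _.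
  by ring.
under eq_bigr do rewrite exchange_big /=.
rewrite exchange_big mulr_sumr; apply: eq_bigr => k _ /=.
under eq_bigr do rewrite exchange_big /=.
rewrite exchange_big mulr_sumr; apply: eq_bigr => l _ /=.
move: (ev2 X (e k) (e l)) => Y; rewrite -levi4_frame /levi4 [in RHS]mulr_sumr raddf_sum mulr_suml mulr_sumr.
apply: eq_bigr => a _; rewrite mulr_sumr raddf_sum mulr_suml mulr_sumr.
apply: eq_bigr => b _; rewrite mulr_sumr raddf_sum mulr_suml mulr_sumr.
apply: eq_bigr => r _; rewrite mulr_sumr raddf_sum mulr_suml mulr_sumr.
by apply: eq_bigr.
Qed.

End OneFrame.
End Dual.

(** * Self-dual two-forms *)

Section SelfDual.
Variable R : rcfType.
Local Notation C := (R[i]).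
Implicit Types (g : 'M[R]_4) (s t u v : vec R) (X Y : ctensor2 R).

Definition antisym2 X := forall a b, X b a = - X a b.

Lemma antisym2_ev2 X s t : antisym2 X -> ev2 X t s = - ev2 X s t.
Proof.
move=> aX; rewrite /ev2 exchange_big -sumrN; apply: eq_bigr => a _.
by rewrite -sumrN; apply: eq_bigr => b _; rewrite aX; ring.
Qed.

Lemma antisym2_diag X s : antisym2 X -> ev2 X s s = 0.
Proof.
move=> aX; have /eqP : ev2 X s s *+ 2 = 0 by rewrite mulr2n {1}(antisym2_ev2 _ _ aX) addNr.
by rewrite mulrn_eq0 => /eqP.
Qed.

Lemma ev2Z X (c : C) s t : ev2 (fun a b => c * X a b) s t = c * ev2 X s t.
Proof.
rewrite /ev2 mulr_sumr; apply: eq_bigr => a _.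
by rewrite mulr_sumr; apply: eq_bigr => b _ /=; ring.
Qed.

Lemma ev2_lin X Y (c d : C) s t :
  ev2 (fun a b => c * X a b + d * Y a b) s t = c * ev2 X s t + d * ev2 Y s t.
Proof.
rewrite /ev2 !mulr_sumr -big_split; apply: eq_bigr => a _.
rewrite !mulr_sumr -big_split; apply: eq_bigr => b _ /=; ring.
Qed.

Lemma eq_ev2 X Y s t : (forall a b, X a b = Y a b) -> ev2 X s t = ev2 Y s t.
Proof. by move=> XY; do 2!apply: eq_bigr => ? _; rewrite XY. Qed.

Lemma cdual_lin g X Y (c d : C) a b :
  cdual g (fun a b => c * X a b + d * Y a b) a b = c * cdual g X a b + d * cdual g Y a b.
Proof.
rewrite /cdual !(mulrCA _ 2^-1) -mulrDr; congr (_ * _).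
do 4!(rewrite !mulr_sumr -big_split; apply: eq_bigr => ? _) => /=; ring.
Qed.

Lemma eq_cdual g X Y a b : (forall a b, X a b = Y a b) -> cdual g X a b = cdual g Y a b.
Proof. by move=> XY; congr (_ * _); do 4!apply: eq_bigr => ? _; rewrite XY. Qed.

Lemma cdual_antisym g X : antisym2 (cdual g X).
Proof.
move=> a b; rewrite /cdual -mulrN; congr (_ * _).
do 4!(rewrite -sumrN; apply: eq_bigr => ? _).
by rewrite /levi perm_symbol_swap12; ring.
Qed.

Lemma dual2_cdual g F a b : cx (dual2 g F a b) = cdual g (fun a b => cx (F a b)) a b.
Proof.
rewrite /dual2 /cdual rmorphM fmorphV rmorph_nat; congr (_ * _).
do 4!(rewrite raddf_sum; apply: eq_bigr => ? _) => /=; ring.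
Qed.

(** The eigenvalue is [i] because [sd2] subtracts [i] times the dual and the dual squares to -1. *)
Definition sdual g X := antisym2 X /\ forall a b, cdual g X a b = 'i%C * X a b.

(* The component (i, j) of the k-th basic self-dual form, sd2 of e_0 wedge e_k,
   in the frame e, where J is frameJ below. *)
Definition sdtab (J : C) (k : 'I_3) (i j : 'I_4) : C :=
  match val k, val i, val j with
  | 0, 0, 1 | 1, 0, 2 | 2, 0, 3 => - 2^-1
  | 0, 1, 0 | 1, 2, 0 | 2, 3, 0 => 2^-1
  | 0, 2, 3 | 1, 3, 1 | 2, 1, 2 => - (J / 2)
  | 0, 3, 2 | 1, 1, 3 | 2, 2, 1 => J / 2
  | _, _, _ => 0
  end.

Definition sdbasis g (e : 'I_4 -> vec R) (k : 'I_3) : ctensor2 R :=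
  sd2 g (wedge g (e i0) (e (lift ord0 k))).

Section OneFrame.
Variables (g : 'M[R]_4) (e : 'I_4 -> vec R).
Hypothesis onb : orthonormal_frame g e.

Local Notation o := (orientation g e).
(* In every orthonormal frame self-duality reads X_23 = J X_01 and cyclically,
   with J = i or J = - i according to the orientation of the frame. *)
Definition frameJ : C := 'i%C * cx o.

Lemma frameJ_sqr : frameJ ^+ 2 = -1.
Proof. by rewrite /frameJ exprMn sqr_i -rmorphXn /= orientation_sqr //= mulr1. Qed.

Lemma frameJ_conj : frameJ^* = - frameJ.
Proof. by apply/eqP; rewrite /frameJ eq_complex /=; apply/andP; split; apply/eqP; ring. Qed.

(** The dual exchanges electric components (0,k) with magnetic ones (2,3), (3,1), (1,2). The minus
    sign of the second triple comes from raising one timelike and one spacelike index. *)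
Lemma cdual_frame_table X : antisym2 X ->
  let f i j := ev2 X (e i) (e j) in
  let h i j := ev2 (cdual g X) (e i) (e j) in
  [/\ h i0 i1 = cx o * f i2 i3, h i0 i2 = cx o * f i3 i1, h i0 i3 = cx o * f i1 i2
    & [/\ h i2 i3 = - cx o * f i0 i1, h i3 i1 = - cx o * f i0 i2 & h i1 i2 = - cx o * f i0 i3]].
Proof.
move=> aX f h.
have af i j : f j i = - f i j by exact: antisym2_ev2.
have hE i j : h i j = 2^-1 * \sum_(k < 4) \sum_(l < 4)
    cx (sgn k * sgn l * (o * perm_symbol R i j k l)) * f k l by exact: cdual_frame.
have e13 i k l : perm_symbol R i k i l = 0 by rewrite /perm_symbol; ring.
have e14 i k l : perm_symbol R i k l i = 0 by rewrite /perm_symbol; ring.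
have e23 i k l : perm_symbol R k i i l = 0 by rewrite /perm_symbol; ring.
have e24 i k l : perm_symbol R k i l i = 0 by rewrite /perm_symbol; ring.
have e34 i k l : perm_symbol R k l i i = 0 by rewrite /perm_symbol; ring.
have p1 : perm_symbol R i0 i1 i2 i3 = 1 by rewrite /perm_symbol /=; field.
have p2 : perm_symbol R i0 i2 i3 i1 = 1 by rewrite /perm_symbol /=; field.
have p3 : perm_symbol R i0 i3 i1 i2 = 1 by rewrite /perm_symbol /=; field.
have p4 : perm_symbol R i2 i3 i0 i1 = 1 by rewrite /perm_symbol /=; field.
have p5 : perm_symbol R i3 i1 i0 i2 = 1 by rewrite /perm_symbol /=; field.
have p6 : perm_symbol R i1 i2 i0 i3 = 1 by rewrite /perm_symbol /=; field.
have p7 : perm_symbol R i0 i1 i3 i2 = -1 by rewrite /perm_symbol /=; field.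
have p8 : perm_symbol R i0 i2 i1 i3 = -1 by rewrite /perm_symbol /=; field.
have p9 : perm_symbol R i0 i3 i2 i1 = -1 by rewrite /perm_symbol /=; field.
have p10 : perm_symbol R i2 i3 i1 i0 = -1 by rewrite /perm_symbol /=; field.
have p11 : perm_symbol R i3 i1 i2 i0 = -1 by rewrite /perm_symbol /=; field.
have p12 : perm_symbol R i1 i2 i3 i0 = -1 by rewrite /perm_symbol /=; field.
have pE := (e13, e14, e23, e24, e34, p1, p2, p3, p4, p5, p6, p7, p8, p9, p10, p11, p12).
split; [..|split]; rewrite hE !sum4 !sgnE !pE ?(af i0 i1) ?(af i0 i2) ?(af i0 i3)
  ?(af i1 i2) ?(af i3 i1) ?(af i2 i3); by field.
Qed.

Lemma cdual_cdual X : antisym2 X -> forall a b, cdual g (cdual g X) a b = - X a b.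
Proof.
move=> aX.
have [t1 t2 t3 [t4 t5 t6]] := cdual_frame_table aX.
have [u1 u2 u3 [u4 u5 u6]] := cdual_frame_table (@cdual_antisym g X).
have o2 : cx o ^+ 2 = 1 by rewrite -rmorphXn /= orientation_sqr.
have aux i j : ev2 (fun a b => - X a b) (e i) (e j) = - ev2 X (e i) (e j).
  by rewrite -mulN1r -ev2Z; apply: eq_ev2 => a b; rewrite mulN1r.
have diag0 Y i : antisym2 Y -> ev2 Y (e i) (e i) = 0 by exact: antisym2_diag.
have flip Y i j : antisym2 Y -> ev2 Y (e j) (e i) = - ev2 Y (e i) (e j).
  exact: antisym2_ev2.
apply: (ev2_ext onb) => i j; rewrite aux.
have aZ := @cdual_antisym g (cdual g X).
move: i j.
suff h : [/\ ev2 (cdual g (cdual g X)) (e i0) (e i1) = - ev2 X (e i0) (e i1),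
  ev2 (cdual g (cdual g X)) (e i0) (e i2) = - ev2 X (e i0) (e i2),
  ev2 (cdual g (cdual g X)) (e i0) (e i3) = - ev2 X (e i0) (e i3) &
  [/\ ev2 (cdual g (cdual g X)) (e i2) (e i3) = - ev2 X (e i2) (e i3),
  ev2 (cdual g (cdual g X)) (e i3) (e i1) = - ev2 X (e i3) (e i1) &
  ev2 (cdual g (cdual g X)) (e i1) (e i2) = - ev2 X (e i1) (e i2)]].
  case: h => h1 h2 h3 [h4 h5 h6].
  move=> i j; elim/ord4_ind: i; elim/ord4_ind: j;
  rewrite ?(diag0 _ _ aZ) ?(diag0 _ _ aX) ?oppr0 ?h1 ?h2 ?h3 ?h4 ?h5 ?h6 //;
  by rewrite (flip _ _ _ aZ) (flip _ _ _ aX) ?h1 ?h2 ?h3 ?h4 ?h5 ?h6.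
split; [..|split].
- rewrite u1 t4; ring: o2.
- rewrite u2 t5; ring: o2.
- rewrite u3 t6; ring: o2.
- rewrite u4 t1; ring: o2.
- rewrite u5 t2; ring: o2.
- rewrite u6 t3; ring: o2.
Qed.

Lemma sd2_sdual F : (forall a b, F b a = - F a b) -> sdual g (sd2 g F).
Proof.
move=> aF; pose Y : ctensor2 R := fun a b => cx (F a b).
have aY : antisym2 Y by move=> a b; rewrite /Y aF rmorphN.
have sdE a b : sd2 g F a b = 2^-1 * Y a b + (- 'i%C / 2) * cdual g Y a b.
  by rewrite /sd2 dual2_cdual -/Y; ring.
split=> a b.
  by rewrite !sdE aY (cdual_antisym g Y a b); ring.
rewrite (eq_cdual _ _ _ sdE) cdual_lin cdual_cdual // sdE.
have := @sqr_i R => hi; ring: hi.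
Qed.

Lemma wedge_antisym s t a b : wedge g s t b a = - wedge g s t a b.
Proof. by rewrite /wedge; ring. Qed.

Definition frame_sdual X := let f i j := ev2 X (e i) (e j) in
  [/\ f i2 i3 = frameJ * f i0 i1, f i3 i1 = frameJ * f i0 i2 & f i1 i2 = frameJ * f i0 i3].

Lemma sdual_frame X : sdual g X -> frame_sdual X.
Proof.
move=> [aX hX] f; have [_ _ _ [t4 t5 t6]] := cdual_frame_table aX.
have i2E := @sqr_i R.
have dE i j : ev2 (cdual g X) (e i) (e j) = 'i%C * f i j.
  by rewrite (eq_ev2 _ _ hX) ev2Z.
rewrite !dE in t4 t5 t6; rewrite -/(f _ _) in t4 t5 t6.
have solve x y : 'i%C * x = - cx o * y -> x = frameJ * y :> C.
  move=> h; have -> : x = - 'i%C * ('i%C * x) by ring: i2E.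
  by rewrite h /frameJ; ring.
by split; apply: solve.
Qed.

(** Self-duality leaves only the three electric components free; -2 inverts the electric component
    -1/2 of a basic form. *)
Lemma frame_sdual_table X : antisym2 X -> frame_sdual X -> forall i j,
  ev2 X (e i) (e j)
  = - 2 * \sum_(k < 3) ev2 X (e i0) (e (lift ord0 k)) * sdtab frameJ k i j.
Proof.
move=> aX [h1 h2 h3].
have diag0 i : ev2 X (e i) (e i) = 0 by exact: antisym2_diag.
have flip i j : ev2 X (e j) (e i) = - ev2 X (e i) (e j) by exact: antisym2_ev2.
move=> i j; rewrite sum3 !liftE.
elim/ord4_ind: i; elim/ord4_ind: j; rewrite /sdtab /= ?diag0 ?(flip i0 i1) ?(flip i0 i2)
  ?(flip i0 i3) ?(flip i1 i2) ?(flip i3 i1) ?(flip i2 i3) ?h1 ?h2 ?h3; by field.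
Qed.

Lemma sdbasis_sdual k : sdual g (sdbasis g e k).
Proof. by apply: sd2_sdual => a b; exact: wedge_antisym. Qed.

Lemma ev2_wedge s t u v :
  ev2 (fun a b => cx (wedge g s t a b)) u v
  = cx (gdot g u s * gdot g v t - gdot g u t * gdot g v s).
Proof.
have lowerE x y : cx (gdot g x y) = \sum_a cx (lower g y a) * cx (x a).
  rewrite /gdot raddf_sum; apply: eq_bigr => a _.
  by rewrite -rmorphM /lower /= mulr_suml; congr (cx _); apply: eq_bigr => b _; ring.
rewrite rmorphB !rmorphM /= !lowerE !mulr_suml -sumrB; apply: eq_bigr => a _.
rewrite !mulr_sumr -sumrB; apply: eq_bigr => b _.
by rewrite /wedge; ring.
Qed.

Lemma ev2_sdbasis k i j : ev2 (sdbasis g e k) (e i) (e j) = sdtab frameJ k i j.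
Proof.
pose Y : ctensor2 R := fun a b => cx (wedge g (e i0) (e (lift ord0 k)) a b).
have aY : antisym2 Y by move=> a b; rewrite /Y wedge_antisym rmorphN.
have sdE a b : sdbasis g e k a b = 2^-1 * Y a b + (- 'i%C / 2) * cdual g Y a b.
  by rewrite /sdbasis /sd2 dual2_cdual -/Y; ring.
have YE i' j' : ev2 Y (e i') (e j') = cx (Defs.eta R i' i0 * Defs.eta R j' (lift ord0 k)
   - Defs.eta R i' (lift ord0 k) * Defs.eta R j' i0) by rewrite ev2_wedge !onb.
have [t1 t2 t3 _] := cdual_frame_table aY.
(* The dual of e_0 wedge e_k is purely magnetic, so the electric components come from half the wedge
   alone; self-duality then gives the others. *)
have row0 l : ev2 (sdbasis g e k) (e i0) (e (lift ord0 l)) = if k == l then - 2^-1 else 0.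
  rewrite (eq_ev2 _ _ sdE) ev2_lin.
  have -> : ev2 (cdual g Y) (e i0) (e (lift ord0 l)) = 0.
    elim/ord3_ind: l; rewrite !liftE ?t1 ?t2 ?t3 YE !mxE /=; by ring.
  by rewrite YE !mxE /=; elim/ord3_ind: k {Y aY sdE YE t1 t2 t3}; elim/ord3_ind: l;
     rewrite !liftE /=; field.
have sF := sdbasis_sdual k.
rewrite (frame_sdual_table sF.1 (sdual_frame sF)) sum3 !row0.
by elim/ord3_ind: k {Y aY sdE YE t1 t2 t3 row0 sF} => /=; field.
Qed.

(** Assumes only the frame relations: in [weyl_sdcoef] the self-duality in the second index pair is
    available in that form. *)
Lemma frame_sdual_basis X : antisym2 X -> frame_sdual X -> forall a b,
  X a b = - 2 * \sum_(k < 3) ev2 X (e i0) (e (lift ord0 k)) * sdbasis g e k a b.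
Proof.
move=> aX sX; apply: (ev2_ext onb) => i j.
rewrite (frame_sdual_table aX sX) ev2Z; congr (_ * _); rewrite !sum3.
under [RHS]eq_ev2 do rewrite sum3.
have -> : forall (A B D : ctensor2 R) (x y z : C) s t,
  ev2 (fun a b => x * A a b + y * B a b + z * D a b) s t
  = x * ev2 A s t + y * ev2 B s t + z * ev2 D s t.
  move=> A B D x y z s t.
  rewrite -(ev2_lin A B) -[X in X + _]mul1r -ev2_lin.
  by apply: eq_ev2 => a b; rewrite mul1r.
by rewrite !ev2_sdbasis.
Qed.

Lemma sdual_basis X : sdual g X -> forall a b,
  X a b = - 2 * \sum_(k < 3) ev2 X (e i0) (e (lift ord0 k)) * sdbasis g e k a b.
Proof. by move=> sX; apply: frame_sdual_basis; [exact: sX.1 | exact: sdual_frame]. Qed.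

End OneFrame.
End SelfDual.

(** * The Bel-Robinson tensor in a canonical tetrad *)

Section Pairing.
Variable R : rcfType.
Local Notation C := (R[i]).
Implicit Types (g : 'M[R]_4) (s t u v : vec R) (X Y : ctensor2 R).

Definition frame_coord g (e : 'I_4 -> vec R) t (j : 'I_4) : R := sgn j * gdot g (e j) t.

(* hermite2 of the k-th and l-th basic self-dual forms, in frame components;
   the second factor is a conjugate, whence - J. *)
Definition pairing (J : C) (k l : 'I_3) (s t : 'I_4 -> R) : C :=
  \sum_(i < 4) cx (sgn i) * (\sum_(j < 4) cx (s j) * sdtab J k i j)
    * (\sum_(j < 4) cx (t j) * sdtab (- J) l i j).

Lemma conj_sdtab (J : C) k i j : (sdtab J k i j)^* = sdtab (J^*) k i j.
Proof.
by elim/ord3_ind: k; elim/ord4_ind: i; elim/ord4_ind: j; rewrite /sdtab /=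
  ?(rmorphN, rmorphM, fmorphV, rmorph_nat, rmorph0).
Qed.
End Pairing.
Section BelRobinsonFactorization.
Variable R : rcfType.
Local Notation C := (R[i]).
Implicit Types (g : 'M[R]_4) (s t u v : vec R) (X Y : ctensor2 R).

Definition hermite2 g X Y : ctensor2 R := fun a c =>
  \sum_(p < 4) \sum_(p' < 4) cx (ginv g p p') * X p' a * (Y p c)^*.

Definition bel_robinson4 g Cw s t u v : C :=
  \sum_(a < 4) \sum_(b < 4) \sum_(c < 4) \sum_(d < 4)
    bel_robinson g Cw a b c d * cx (s a) * cx (t b) * cx (u c) * cx (v d).

(* Substituting the expansion of the self-dual Weyl tensor splits the double
   contraction into a product of two single ones. *)
Lemma bel_robinson_factor g Cw (n : nat) (F : 'I_n -> ctensor2 R) (sigma : 'I_n -> C) :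
  (forall k, antisym2 (F k)) ->
  (forall a b c d, sd4 g Cw a b c d = \sum_k sigma k * F k a b * F k c d) ->
  forall a b c d, bel_robinson g Cw a b c d
    = \sum_k \sum_l sigma k * (sigma l)^*
        * hermite2 g (F k) (F l) a c * hermite2 g (F k) (F l) b d.
Proof.
move=> aF sdE a b c d; rewrite /bel_robinson.
transitivity (\sum_(p < 4) \sum_(q < 4) \sum_(p' < 4) \sum_(q' < 4) \sum_k \sum_l
   sigma k * (sigma l)^* * ((cx (ginv g p p') * F k p' a * (F l p c)^* )
   * (cx (ginv g q q') * F k q' b * (F l q d)^* ))).
  do 4!apply: eq_bigr => ? _; rewrite !sdE raddf_sum mulr_sumr mulr_suml.
  apply: eq_bigr => k _; rewrite mulr_sumr; apply: eq_bigr => l _.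
  (* One index pair is flipped in each of the two Weyl factors; the signs cancel, and a pairs with
     c, b with d. *)
  by rewrite (aF k _ b) (aF l _ d) /=; ring.
transitivity (\sum_k \sum_l \sum_(p < 4) \sum_(q < 4) \sum_(p' < 4) \sum_(q' < 4)
   sigma k * (sigma l)^* * ((cx (ginv g p p') * F k p' a * (F l p c)^* )
   * (cx (ginv g q q') * F k q' b * (F l q d)^* ))).
  have ex (G : 'I_4 -> 'I_4 -> 'I_4 -> 'I_4 -> 'I_n -> C) :
    \sum_p \sum_q \sum_p' \sum_q' \sum_k G p q p' q' k
    = \sum_k \sum_p \sum_q \sum_p' \sum_q' G p q p' q' k.
    rewrite [RHS]exchange_big; apply: eq_bigr => p _.
    rewrite [RHS]exchange_big; apply: eq_bigr => q _.
    rewrite [RHS]exchange_big; apply: eq_bigr => p' _.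
    by rewrite [RHS]exchange_big; apply: eq_bigr => q' _.
  by rewrite ex; apply: eq_bigr => k _; rewrite ex.
apply: eq_bigr => k _; apply: eq_bigr => l _.
rewrite /hermite2 -mulrA mulr_suml mulr_sumr; apply: eq_bigr => p _.
rewrite mulr_sumr mulr_sumr; apply: eq_bigr => q _.
rewrite mulr_suml mulr_sumr; apply: eq_bigr => p' _.
rewrite mulr_sumr mulr_sumr; apply: eq_bigr => q' _.
by [].
Qed.

Lemma bel_robinson4_factor g Cw (n : nat) (F : 'I_n -> ctensor2 R) (sigma : 'I_n -> C) :
  (forall k, antisym2 (F k)) ->
  (forall a b c d, sd4 g Cw a b c d = \sum_k sigma k * F k a b * F k c d) ->
  forall s t u v, bel_robinson4 g Cw s t u v
    = \sum_k \sum_l sigma k * (sigma l)^*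
        * ev2 (hermite2 g (F k) (F l)) s u * ev2 (hermite2 g (F k) (F l)) t v.
Proof.
move=> aF sdE s t u v; rewrite /bel_robinson4.
transitivity (\sum_k \sum_l \sum_(a < 4) \sum_(c < 4) \sum_(b < 4) \sum_(d < 4)
   sigma k * (sigma l)^* * ((hermite2 g (F k) (F l) a c * cx (s a) * cx (u c))
     * (hermite2 g (F k) (F l) b d * cx (t b) * cx (v d)))); last first.
  apply: eq_bigr => k _; apply: eq_bigr => l _.
  rewrite /ev2 -mulrA mulr_suml mulr_sumr; apply: eq_bigr => a _.
  rewrite mulr_suml mulr_sumr; apply: eq_bigr => c _.
  rewrite mulr_sumr mulr_sumr; apply: eq_bigr => b _.
  by rewrite mulr_sumr mulr_sumr; apply: eq_bigr => d _.
have ex (G : 'I_4 -> 'I_4 -> 'I_4 -> 'I_4 -> 'I_n -> C) :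
  \sum_p \sum_q \sum_p' \sum_q' \sum_k G p q p' q' k
  = \sum_k \sum_p \sum_q \sum_p' \sum_q' G p q p' q' k.
  rewrite [RHS]exchange_big; apply: eq_bigr => p _.
  rewrite [RHS]exchange_big; apply: eq_bigr => q _.
  rewrite [RHS]exchange_big; apply: eq_bigr => p' _.
  by rewrite [RHS]exchange_big; apply: eq_bigr => q' _.
under [RHS]eq_bigr => k _ do rewrite -ex.
rewrite -ex; apply: eq_bigr => a _; rewrite exchange_big; apply: eq_bigr => b _.
apply: eq_bigr => c _; apply: eq_bigr => d _.
rewrite (bel_robinson_factor aF sdE) !mulr_suml; apply: eq_bigr => k _.
by rewrite !mulr_suml; apply: eq_bigr => l _; ring.
Qed.

Section OneFrame.
Variables (g : 'M[R]_4) (e : 'I_4 -> vec R).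
Hypothesis onb : orthonormal_frame g e.
Local Notation J := (frameJ g e).

Lemma ev2_coord X s t : ev2 X s t = \sum_(j < 4) cx (frame_coord g e t j) * ev2 X s (e j).
Proof.
rewrite ev2E {1}/ev1 (eq_bigr (fun a => \sum_(j < 4)
   cx (frame_coord g e t j) * (ev1 (X a) (e j) * cx (s a)))); last first.
  move=> a _; rewrite (ev1_frame onb) mulr_suml; apply: eq_bigr => j _.
  by rewrite /frame_coord mulrA.
rewrite exchange_big; apply: eq_bigr => j _.
by rewrite -mulr_sumr ev2E.
Qed.

Lemma ev2_sdbasis_coord k i t :
  ev2 (sdbasis g e k) (e i) t = \sum_(j < 4) cx (frame_coord g e t j) * sdtab J k i j.
Proof. by rewrite ev2_coord; apply: eq_bigr => j _; rewrite ev2_sdbasis. Qed.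

Lemma ev2_hermite2 X Y s t : ev2 (hermite2 g X Y) s t
  = \sum_(i < 4) cx (sgn i) * ev2 X (e i) s * (ev2 Y (e i) t)^*.
Proof.
have hE a c : hermite2 g X Y a c = \sum_(i < 4)
   cx (sgn i) * ev1 (fun p => X p a) (e i) * (ev1 (fun p => Y p c) (e i))^*.
  rewrite /hermite2 (eq_bigr (fun p => \sum_(i < 4)
     cx (sgn i) * ev1 (fun p => X p a) (e i) * (Y p c * cx (e i p))^*)); last first.
    move=> p _; rewrite -mulr_suml (ginv_contract onb) mulr_suml.
    apply: eq_bigr => i _.
    have -> : (Y p c * cx (e i p))^* = (Y p c)^* * cx (e i p).
      by rewrite rmorphM; congr (_ * _); exact: conjc_real.
    by ring.
  rewrite exchange_big; apply: eq_bigr => i _.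
  by rewrite -mulr_sumr raddf_sum.
have evT Z i u : ev2 Z (e i) u = \sum_(a < 4) ev1 (fun p => Z p a) (e i) * cx (u a).
  rewrite /ev2 exchange_big; apply: eq_bigr => a _.
  by rewrite mulr_suml.
transitivity (\sum_(a < 4) \sum_(c < 4) \sum_(i < 4) cx (sgn i)
   * (ev1 (fun p => X p a) (e i) * cx (s a)) * (ev1 (fun p => Y p c) (e i) * cx (t c))^*).
  apply: eq_bigr => a _; apply: eq_bigr => c _; rewrite hE !mulr_suml.
  apply: eq_bigr => i _.
  have -> : (ev1 (fun p => Y p c) (e i) * cx (t c))^*
     = (ev1 (fun p => Y p c) (e i))^* * cx (t c).
    by rewrite rmorphM; congr (_ * _); exact: conjc_real.
  by ring.
under eq_bigr do rewrite exchange_big /=.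
rewrite exchange_big; apply: eq_bigr => i _.
rewrite !evT raddf_sum -mulrA mulr_suml mulr_sumr; apply: eq_bigr => a _.
rewrite mulr_sumr mulr_sumr; apply: eq_bigr => c _; exact: esym (mulrA _ _ _).
Qed.

Lemma ev2_hermite2_sdbasis k l s t :
  ev2 (hermite2 g (sdbasis g e k) (sdbasis g e l)) s t
  = pairing J k l (frame_coord g e s) (frame_coord g e t).
Proof.
rewrite ev2_hermite2 /pairing; apply: eq_bigr => i _.
rewrite !ev2_sdbasis_coord raddf_sum; congr (_ * _); apply: eq_bigr => j _.
apply: etrans (rmorphM Num.conj _ _) _; congr (_ * _); first exact: conjc_real.
by rewrite -(frameJ_conj g e); exact: conj_sdtab.
Qed.

Lemma gdot_coord s t : gdot g s t = \sum_(i < 4) sgn i * frame_coord g e s i * frame_coord g e t i.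
Proof.
have lin (A : 'I_4 -> R) u : \sum_a A a * u a
   = \sum_(i < 4) frame_coord g e u i * \sum_a A a * e i a.
  rewrite (eq_bigr (fun a => \sum_(i < 4) frame_coord g e u i * (A a * e i a))); last first.
    move=> a _; rewrite {1}(frame_expand onb u a) mulr_sumr; apply: eq_bigr => i _.
    by rewrite /frame_coord; ring.
  by rewrite exchange_big; apply: eq_bigr => i _; rewrite -mulr_sumr.
have gE u v : gdot g u v = \sum_a (\sum_b g a b * v b) * u a.
  by apply: eq_bigr => a _; rewrite mulr_suml; apply: eq_bigr => b _; ring.
rewrite gE lin; apply: eq_bigr => i _.
have -> : \sum_a (\sum_b g a b * t b) * e i a = gdot g (e i) t by rewrite gE.
by have := sgn_sqr R i; rewrite /frame_coord => h; ring: h.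
Qed.

End OneFrame.
End BelRobinsonFactorization.

(** * Closed forms of the quartic and of its radial slope *)

Section CanonicalQuartic.
Variable R : rcfType.
Local Notation C := (R[i]).
Variables (J : C) (sigma : 'I_3 -> C) (t : 'I_4 -> R).
Hypotheses (hJ : J ^+ 2 = -1) (hs : sigma j1 + sigma j2 + sigma j3 = 0).
Hypothesis ht : t i0 ^+ 2 = 1 + (t i1 ^+ 2 + t i2 ^+ 2 + t i3 ^+ 2).

Let T (s : 'I_4 -> R) := \sum_k \sum_l sigma k * (sigma l)^* * pairing J k l s t * pairing J k l t t.

Let t0 := cx (t i0).
Let n1 := cx (t i1).
Let n2 := cx (t i2).
Let n3 := cx (t i3).

Let htC : t0 ^+ 2 = 1 + (n1 ^+ 2 + n2 ^+ 2 + n3 ^+ 2).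
Proof. by rewrite -!rmorphXn /= ht !(rmorphD, rmorph1). Qed.

Definition time_coord (i : 'I_4) : R := (i == i0)%:R.

Let pE : [/\ pairing J j1 j1 t t = - 4^-1 * (t0 ^+ 2 + n2 ^+ 2 + n3 ^+ 2 - n1 ^+ 2),
 pairing J j2 j2 t t = - 4^-1 * (t0 ^+ 2 + n1 ^+ 2 + n3 ^+ 2 - n2 ^+ 2) &
 pairing J j3 j3 t t = - 4^-1 * (t0 ^+ 2 + n2 ^+ 2 + n1 ^+ 2 - n3 ^+ 2)].
Proof.
by split; rewrite /pairing !sum4 !sgnE /sdtab /t0 /n1 /n2 /n3 /=; field: hJ.
Qed.

Let pE2 : [/\ pairing J j1 j2 t t = 2^-1 * (n1 * n2 + J * t0 * n3),
 pairing J j2 j3 t t = 2^-1 * (n2 * n3 + J * t0 * n1) &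
 pairing J j3 j1 t t = 2^-1 * (n3 * n1 + J * t0 * n2)].
Proof.
by split; rewrite /pairing !sum4 !sgnE /sdtab /t0 /n1 /n2 /n3 /=; field: hJ.
Qed.

Let pE3 : [/\ pairing J j2 j1 t t = 2^-1 * (n1 * n2 - J * t0 * n3),
 pairing J j3 j2 t t = 2^-1 * (n2 * n3 - J * t0 * n1) &
 pairing J j1 j3 t t = 2^-1 * (n3 * n1 - J * t0 * n2)].
Proof.
by split; rewrite /pairing !sum4 !sgnE /sdtab /t0 /n1 /n2 /n3 /=; field: hJ.
Qed.

Lemma quartic_gap : 16 * T t = sigma j1 * (sigma j1)^* + sigma j2 * (sigma j2)^*
   + sigma j3 * (sigma j3)^*
   + 4 * energy_gap J t0 n1 n2 n3 (sigma j2 - sigma j3) (sigma j3 - sigma j1).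
Proof.
case: pE => p1 p2 p3; case: pE2 => q1 q2 q3; case: pE3 => r1 r2 r3.
rewrite /T !sum3 p1 p2 p3 q1 q2 q3 r1 r2 r3 /energy_gap /hform.
(* After this elimination the claim is a polynomial identity modulo J^2 = -1 and the unit
   condition. *)
have -> : sigma j3 = - sigma j1 - sigma j2.
  by apply/eqP; rewrite -subr_eq0 -[X in _ == X]hs; apply/eqP; ring.
by field: hJ htC.
Qed.

Lemma quartic_slope : 8 * (t0 * (t0 * T t - T time_coord))
   = radial_slope J t0 n1 n2 n3 (sigma j2 - sigma j3) (sigma j3 - sigma j1).
Proof.
have tcE : (cx (time_coord i0) = 1) * (cx (time_coord i1) = 0) * (cx (time_coord i2) = 0) * (cx (time_coord i3) = 0).
  by rewrite /time_coord /= rmorph0 rmorph1.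
have [o1 o2 o3] : [/\ pairing J j1 j1 time_coord t = - 4^-1 * t0,
  pairing J j2 j2 time_coord t = - 4^-1 * t0 & pairing J j3 j3 time_coord t = - 4^-1 * t0].
  by split; rewrite /pairing !sum4 !sgnE !tcE /sdtab /t0 /=; field: hJ.
have [q1' q2' q3'] : [/\ pairing J j1 j2 time_coord t = 4^-1 * (J * n3),
  pairing J j2 j3 time_coord t = 4^-1 * (J * n1) & pairing J j3 j1 time_coord t = 4^-1 * (J * n2)].
  by split; rewrite /pairing !sum4 !sgnE !tcE /sdtab /n1 /n2 /n3 /=; field: hJ.
have [r1' r2' r3'] : [/\ pairing J j2 j1 time_coord t = - 4^-1 * (J * n3),
  pairing J j3 j2 time_coord t = - 4^-1 * (J * n1) & pairing J j1 j3 time_coord t = - 4^-1 * (J * n2)].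
  by split; rewrite /pairing !sum4 !sgnE !tcE /sdtab /n1 /n2 /n3 /=; field: hJ.
case: pE => p1 p2 p3; case: pE2 => q1 q2 q3; case: pE3 => r1 r2 r3.
rewrite /T !sum3 p1 p2 p3 q1 q2 q3 r1 r2 r3 o1 o2 o3 q1' q2' q3' r1' r2' r3'.
rewrite /radial_slope /hform.
have -> : sigma j3 = - sigma j1 - sigma j2.
  by apply/eqP; rewrite -subr_eq0 -[X in _ == X]hs; apply/eqP; ring.
by field: hJ htC.
Qed.

End CanonicalQuartic.

Lemma vec_eq_dec (R : rcfType) (u v : vec R) : u = v \/ u <> v.
Proof.
have [/forallP uv|/forallP uv] := boolP [forall p, u p == v p].
  by left; apply: functional_extensionality => p; apply/eqP.
by right=> uvE; apply: uv => p; rewrite uvE.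
Qed.

Section Momentum.
Variable R : rcfType.
Implicit Types (g : 'M[R]_4) (Cw : tensor4 R) (s u : vec R).

Definition br_momentum g Cw u (b : 'I_4) : R[i] :=
  \sum_(c < 4) \sum_(d < 4) \sum_(e < 4)
    bel_robinson g Cw b c d e * cx (u c) * cx (u d) * cx (u e).

Lemma br_alignedE g Cw u : br_aligned g Cw u <-> forall a b,
  cx (lower g u a) * br_momentum g Cw u b - cx (lower g u b) * br_momentum g Cw u a = 0.
Proof. by []. Qed.

Lemma ev1_br_momentum g Cw u s : ev1 (br_momentum g Cw u) s = bel_robinson4 g Cw s u u u.
Proof.
apply: eq_bigr => b _.
rewrite mulr_suml; apply: eq_bigr => c _; rewrite mulr_suml; apply: eq_bigr => d _.
by rewrite mulr_suml; apply: eq_bigr => f _; ring.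
Qed.

Lemma ev1_lower g u s : ev1 (fun a => cx (lower g u a)) s = cx (gdot g s u).
Proof.
rewrite /gdot raddf_sum; apply: eq_bigr => a _.
by rewrite -rmorphM /lower /= mulr_suml; congr (cx _); apply: eq_bigr => b _; ring.
Qed.

End Momentum.

(** * Minimum and critical points relative to a canonical tetrad *)

Section Canonical.
Variable R : rcfType.
Local Notation C := (R[i]).
Variables (g : 'M[R]_4) (Cw : tensor4 R) (tau v x y z : vec R) (s1 s2 s3 : C).
Hypothesis canon : petrov_canonical_form g Cw v x y z s1 s2 s3.

Let e := tetrad_vec v x y z.
Let onb : orthonormal_frame g e. Proof. by case: canon. Qed.
Let s_sum : s1 + s2 + s3 = 0. Proof. by case: canon => _ []. Qed.

Let sigma (k : 'I_3) : C := match val k with 0 => s1 | 1 => s2 | _ => s3 end.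

Let sd4E a b c d : sd4 g Cw a b c d
  = \sum_k sigma k * sdbasis g e k a b * sdbasis g e k c d.
Proof. by case: canon => _ [_ ->]; rewrite sum3 /sdbasis !liftE. Qed.

Let J := frameJ g e.
Let hJ : J ^+ 2 = -1. Proof. exact: frameJ_sqr. Qed.
Let hJc : J^* = - J. Proof. exact: frameJ_conj. Qed.

Let br4E s t : bel_robinson4 g Cw s t t t = \sum_k \sum_l sigma k * (sigma l)^*
  * pairing J k l (frame_coord g e s) (frame_coord g e t) * pairing J k l (frame_coord g e t) (frame_coord g e t).
Proof.
rewrite (bel_robinson4_factor (fun k => (sdbasis_sdual onb k).1) sd4E).
by do 2!apply: eq_bigr => ? _; rewrite !(ev2_hermite2_sdbasis onb).
Qed.

Lemma unit_coord t : gdot g t t = 1 -> frame_coord g e t i0 ^+ 2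
  = 1 + (frame_coord g e t i1 ^+ 2 + frame_coord g e t i2 ^+ 2 + frame_coord g e t i3 ^+ 2).
Proof.
by rewrite (gdot_coord onb) sum4 !sgnE => <-; ring.
Qed.

Lemma coord_frame i j : frame_coord g e (e i) j = (j == i)%:R.
Proof.
rewrite /frame_coord onb etaE; case: eqP => [->|_]; last by rewrite mulr0.
exact: sgn_sqr.
Qed.

Lemma br_quartic_canonical t : gdot g t t = 1 ->
  br_quartic g Cw t = petrov_value s1 s2 s3
    + 4^-1 * energy_gap J (cx (frame_coord g e t i0)) (cx (frame_coord g e t i1))
        (cx (frame_coord g e t i2)) (cx (frame_coord g e t i3)) (s2 - s3) (s3 - s1).
Proof.
move=> /unit_coord ht; have := @quartic_gap R J sigma (frame_coord g e t) hJ s_sum ht; cbv beta.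
rewrite -br4E /petrov_value !normCK => h.
have -> : br_quartic g Cw t = 16^-1 * (16 * bel_robinson4 g Cw t t t t).
  by rewrite mulKf // pnatr_eq0.
by rewrite h /sigma /=; field.
Qed.

Lemma petrov_value_min t : gdot g t t = 1 ->
  petrov_value s1 s2 s3 <= br_quartic g Cw t.
Proof.
move=> ht; rewrite br_quartic_canonical // lerDl mulr_ge0 ?invr_ge0 ?ler0n //.
have htC := congr1 (fun r : R => cx r) (unit_coord ht).
apply: energy_gap_ge0 => //; try exact: conjc_real.
by move: htC; rewrite !(rmorphXn, rmorphD, rmorph1).
Qed.

Lemma br_quartic_timelike : br_quartic g Cw v = petrov_value s1 s2 s3.
Proof.
have hv : gdot g v v = 1 by have := onb i0 i0; rewrite mxE.
rewrite br_quartic_canonical // (_ : v = e i0) // !coord_frame /=.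
by rewrite /energy_gap /hform rmorph0; ring.
Qed.

Lemma coord_reconstruct t p : t p = \sum_i frame_coord g e t i * e i p.
Proof. exact: frame_expand. Qed.

(** Without spatial coordinates a unit vector is [v] or its opposite; the time orientation rejects
    the latter. *)
Lemma future_timelike_eq t : future_unit g tau v -> future_unit g tau t ->
  frame_coord g e t i1 = 0 -> frame_coord g e t i2 = 0 -> frame_coord g e t i3 = 0 -> t = v.
Proof.
move=> [_ fv] [ht ft] h1 h2 h3.
have tE p : t p = frame_coord g e t i0 * v p.
  by rewrite coord_reconstruct sum4 h1 h2 h3 !mul0r !addr0.
have gE : gdot g t tau = frame_coord g e t i0 * gdot g v tau.
  rewrite /gdot mulr_sumr; apply: eq_bigr => a _; rewrite mulr_sumr.
  by apply: eq_bigr => b _; rewrite tE; ring.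
have := unit_coord ht; rewrite h1 h2 h3 expr0n !addr0 => /eqP.
rewrite sqrf_eq1 => /orP[] /eqP c0; apply: functional_extensionality => p.
  by rewrite tE c0 mul1r.
by move: ft; rewrite gE c0 mulN1r oppr_gt0 ltNge (ltW fv).
Qed.

(** The components T(e_i, v, v, v) with i spatial vanish: the factor at (v, v) is zero unless k = l,
    and for k = l the factor at (e_i, v) is zero. *)
Lemma canonical_aligned : br_aligned g Cw v.
Proof.
rewrite br_alignedE; set W := br_momentum g Cw v.
suff h : W =1 (fun a => ev1 W v * cx (lower g v a)) by move=> a b; rewrite !h; ring.
apply: (ev1_ext onb) => i.
have -> : ev1 (fun a => ev1 W v * cx (lower g v a)) (e i) = ev1 W v * cx (gdot g (e i) (e i0)).
  by rewrite -ev1_lower mulr_sumr; apply: eq_bigr => a _; rewrite -mulrA.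
rewrite onb etaE !ev1_br_momentum !br4E (_ : v = e i0) //.
have coordE j : frame_coord g e (e j) = fun k => (k == j)%:R.
  by apply: functional_extensionality => k; rewrite coord_frame.
rewrite !coordE.
have p0 k l : pairing J k l (fun j => (j == i0)%:R) (fun j => (j == i0)%:R)
   = if k == l then - 4^-1 else 0.
  rewrite /pairing !sum4 !sgnE /sdtab /= !rmorph0 !rmorph1.
  by elim/ord3_ind: k; elim/ord3_ind: l => /=; field.
have pi k : i != i0 ->
    pairing J k k (fun j => (j == i)%:R) (fun j => (j == i0)%:R) = 0.
  rewrite /pairing !sum4 !sgnE /sdtab /=.
  by elim/ord4_ind: i; elim/ord3_ind: k => //= _; rewrite !rmorph0 !rmorph1; field.
have [->|ni] := eqVneq i i0; first by rewrite sgnE rmorph1 mulr1.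
rewrite rmorph0 mulr0 big1 // => k _; rewrite big1 // => l _; rewrite p0.
by case: eqP => [->|_]; rewrite ?mulr0 // pi // mulr0 mul0r.
Qed.

Section Distinct.
Hypotheses (s12 : s1 != s2) (s23 : s2 != s3) (s31 : s3 != s1).

Let delta12 : (s2 - s3) + (s3 - s1) != 0.
Proof. by rewrite addrA subrK subr_eq0 eq_sym. Qed.

Let unit_coordC t : gdot g t t = 1 -> cx (frame_coord g e t i0) ^+ 2
  = 1 + (cx (frame_coord g e t i1) ^+ 2 + cx (frame_coord g e t i2) ^+ 2 + cx (frame_coord g e t i3) ^+ 2).
Proof.
move=> ht; have := congr1 (fun r : R => cx r) (unit_coord ht).
by rewrite !(rmorphXn, rmorphD, rmorph1).
Qed.

Let coord_neq0 t : future_unit g tau v -> future_unit g tau t -> t <> v ->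
  [|| cx (frame_coord g e t i1) != 0 :> C, cx (frame_coord g e t i2) != 0 :> C | cx (frame_coord g e t i3) != 0 :> C].
Proof.
move=> fv ft tv; rewrite -!negb_and; apply/negP => /and3P[].
rewrite !fmorph_eq0 => /eqP h1 /eqP h2 /eqP h3.
exact/tv/future_timelike_eq.
Qed.

Lemma petrov_value_lt t : future_unit g tau v -> future_unit g tau t -> t <> v ->
  petrov_value s1 s2 s3 < br_quartic g Cw t.
Proof.
move=> fv ft tv; have [ht _] := ft.
rewrite br_quartic_canonical // ltrDl mulr_gt0 ?invr_gt0 ?ltr0n //.
by apply: energy_gap_gt0; rewrite ?subr_eq0 ?coord_neq0 ?unit_coordC //; exact: conjc_real.
Qed.

Lemma aligned_timelike u : future_unit g tau v -> future_unit g tau u ->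
  br_aligned g Cw u -> u = v.
Proof.
move=> fv fu al; have [hu _] := fu; have ht := unit_coord hu.
case: (vec_eq_dec u v) => // uv.
(* Contract the alignment condition with u^a v^b and use g(u,u) = 1. As g(v,u) is the time
   coordinate of [u], this makes the left side of [quartic_slope] vanish, against strict positivity
   of the slope. *)
have key : bel_robinson4 g Cw v u u u = cx (gdot g v u) * bel_robinson4 g Cw u u u u.
  rewrite -!ev1_br_momentum -ev1_lower.
  apply/eqP; rewrite -subr_eq0; apply/eqP.
  transitivity (\sum_a \sum_b (cx (lower g u a) * br_momentum g Cw u b
    - cx (lower g u b) * br_momentum g Cw u a) * cx (u a) * cx (v b)); last first.
    by rewrite big1 // => a _; rewrite big1 // => b _; rewrite al !mul0r.
  transitivity (ev1 (fun a => cx (lower g u a)) u * ev1 (br_momentum g Cw u) v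
    - ev1 (fun a => cx (lower g u a)) v * ev1 (br_momentum g Cw u) u).
    by rewrite [ev1 (fun a => cx (lower g u a)) u]ev1_lower hu rmorph1 mul1r.
  rewrite [X in X - _]mulr_suml [X in _ - X]mulrC [X in _ - X]mulr_suml -sumrB.
  apply: eq_bigr => a _; rewrite !mulr_sumr -sumrB; apply: eq_bigr => b _; ring.
have := @quartic_slope R J sigma (frame_coord g e u) hJ s_sum ht; cbv beta.
have <- : frame_coord g e v = time_coord R.
  by apply: functional_extensionality => j; rewrite (_ : v = e i0) // coord_frame.
rewrite -!br4E key.
have -> : cx (frame_coord g e u i0) = cx (gdot g v u) by rewrite /frame_coord sgnE mul1r.
rewrite subrr !mulr0 => /esym slope0.
have : 0 < radial_slope J (cx (gdot g v u)) (cx (frame_coord g e u i1))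
    (cx (frame_coord g e u i2)) (cx (frame_coord g e u i3)) (s2 - s3) (s3 - s1).
  have -> : cx (gdot g v u) = cx (frame_coord g e u i0) by rewrite /frame_coord sgnE mul1r.
  by apply: radial_slope_gt0; rewrite ?subr_eq0 ?coord_neq0 ?unit_coordC //; exact: conjc_real.
by rewrite slope0 ltxx.
Qed.

End Distinct.
End Canonical.

(** * Existence of a canonical tetrad *)

Section OrthogonalDiagonalization.
Variables (C : numClosedFieldType) (n : nat) (A : 'M[C]_n) (m : 'I_n -> C).
Hypotheses (A_sym : A^T = A) (m_inj : injective m).
Hypothesis m_eigen : forall i, eigenvalue A (m i).

Let D := diag_mx (\row_i m i).

(** Since W A = D W, the left kernel of W is stable under D - a for every scalar a. Multiplying by D
    - m j for all j other than i isolates the i-th coefficient of a kernel vector. *)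
Lemma eigenvector_unitmx (W : 'M[C]_n) :
  W *m A = D *m W -> (forall i, row i W != 0) -> W \in unitmx.
Proof.
move=> WA W_neq0; rewrite -row_free_unit -kermx_eq0; apply/eqP/row_matrixP=> k0.
rewrite row0; set c := row k0 _.
have cW : c *m W = 0 by rewrite -row_mul mulmx_ker row0.
have cW_prod (s : seq C) : (\row_k (c 0 k * \prod_(a <- s) (m k - a))) *m W = 0.
  elim: s => [|a s IH].
    rewrite -[RHS]cW; congr (_ *m _); apply/rowP=> k.
    by rewrite mxE big_nil mulr1.
  have -> : \row_k (c 0 k * \prod_(b <- a :: s) (m k - b))
    = (\row_k (c 0 k * \prod_(b <- s) (m k - b))) *m (D - a%:M).
    apply/rowP=> k; rewrite mulmxBr mul_mx_diag mul_mx_scalar !mxE big_cons; ring.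
  by rewrite -mulmxA mulmxBl -WA mul_scalar_mx mulmxBr -scalemxAr mulmxA IH
     mul0mx scaler0 subr0.
apply/rowP=> i; rewrite [RHS]mxE; apply/eqP; apply: contraT => ci.
have := cW_prod [seq m j | j <- enum (predC1 i)].
rewrite (_ : \row_k _ = (c 0 i * \prod_(a <- [seq m j | j <- enum (predC1 i)]) (m i - a))
   *: delta_mx 0 i); last first.
  apply/rowP=> k; rewrite !mxE eqxx /=; have [->|ki] := eqVneq k i; first by rewrite mulr1.
  have kin : k \in enum (predC1 i) by rewrite mem_enum inE.
  by rewrite mulr0 big_map (big_rem k kin) /= subrr mul0r mulr0.
rewrite -scalemxAl -rowE => /eqP; rewrite scaler_eq0 (negbTE (W_neq0 i)) orbF.
rewrite mulf_eq0 (negbTE ci) big_map prodf_seq_eq0 => /hasP[j].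
rewrite mem_enum /= inE => ji; rewrite subr_eq0 => /eqP/m_inj ij.
by rewrite ij eqxx in ji.
Qed.

(** The bilinear Gram matrix G = W W^T of the eigenvectors commutes with D, hence is diagonal. It is
    also invertible, so no eigenvector is isotropic and each can be divided by a square root of its
    G i i. *)
Lemma orthogonal_diagonalization :
  exists O : 'M[C]_n, O *m O^T = 1%:M /\ A = O^T *m D *m O.
Proof.
have [w wA w0] : exists2 w : 'I_n -> 'rV[C]_n,
    forall i, w i *m A = m i *: w i & forall i, w i != 0.
  have h i : exists2 v : 'rV[C]_n, v *m A = m i *: v & v != 0 by apply/eigenvalueP/m_eigen.
  by have [w w1 w2] := fin_all_exists2 h; exists w.
pose W := \matrix_i w i.
have WA : W *m A = D *m W.
  apply/row_matrixP=> i; rewrite row_mul rowK wA.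
  by apply/rowP=> j; rewrite mul_diag_mx !mxE.
have Wu : W \in unitmx by apply: eigenvector_unitmx => // i; rewrite rowK.
pose G := W *m W^T.
have Goff i j : i != j -> G i j = 0.
  move=> ij; have GD : D *m G = G *m D.
    rewrite /G mulmxA -WA -mulmxA -{1}A_sym -trmx_mul WA trmx_mul tr_diag_mx.
    by rewrite mulmxA.
  have := congr1 (fun M : 'M[C]_n => M i j) GD.
  rewrite mul_diag_mx mul_mx_diag !mxE => /eqP.
  rewrite mulrC -subr_eq0 -mulrBr mulf_eq0 subr_eq0 (inj_eq m_inj) (negbTE ij) orbF.
  by move/eqP.
have Gd i : G i i != 0.
  apply/eqP => Gi; have Gu : G \in unitmx by rewrite unitmx_mul Wu unitmx_tr.
  have : row i G = 0.
    apply/rowP=> j; rewrite !mxE; have [<-|ij] := eqVneq i j; first by rewrite -[RHS]Gi mxE.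
    by rewrite -[RHS](Goff i j ij) mxE.
  move/(congr1 (mulmx^~ (invmx G))); rewrite -row_mul mulmxV // mul0mx.
  move/rowP/(_ i); rewrite !mxE eqxx => /eqP; by rewrite oner_eq0.
pose O := \matrix_i ((sqrtC (G i i))^-1 *: w i).
have OO : O *m O^T = 1%:M.
  apply/matrixP=> i j; rewrite !mxE.
  transitivity ((sqrtC (G i i))^-1 * (sqrtC (G j j))^-1 * G i j).
    rewrite [G i j]mxE mulr_sumr; apply: eq_bigr => k _; rewrite !mxE; ring.
  have [->|ij] := eqVneq i j; last by rewrite (Goff i j ij) mulr0.
  by rewrite -invfM -expr2 sqrtCK mulVf.
exists O; split=> //.
have OA : O *m A = D *m O.
  apply/row_matrixP=> i; rewrite row_mul rowK -scalemxAl wA.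
  by apply/rowP=> j; rewrite mul_diag_mx !mxE; ring.
by rewrite -mulmxA -OA mulmxA (mulmx1C OO) mul1mx.
Qed.

End OrthogonalDiagonalization.

(** * The velocity hidden in a complex rotation *)

Section BoostParameter.
Variable R : rcfType.

Let sqn n (x : 'rV[R]_n) : R := (x *m x^T) 0 0.

Let sqnE n (x : 'rV[R]_n) : sqn x = \sum_k x 0 k ^+ 2.
Proof. by rewrite /sqn mxE; apply: eq_bigr => k _; rewrite mxE expr2. Qed.

Let sqn_ge0 n (x : 'rV[R]_n) : 0 <= sqn x.
Proof. by rewrite sqnE sumr_ge0 // => k _; rewrite sqr_ge0. Qed.

Let sqn_eq0 n (x : 'rV[R]_n) : sqn x = 0 -> x = 0.
Proof.
rewrite sqnE => /psumr_eq0P h; apply/rowP=> k; rewrite mxE; apply/eqP.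
by rewrite -sqrf_eq0; apply/eqP/h => // j _; rewrite sqr_ge0.
Qed.

(* The hypotheses say that a + i b is complex orthogonal. They make
   K = a^-1 b antisymmetric, i.e. each row satisfies b_i = a_i x beta, and
   1 - K K^T = a^-1 a^-T is positive definite, which gives |beta| < 1. *)
Lemma boost_parameter (a b : 'M[R]_3) :
  a *m a^T - b *m b^T = 1%:M -> a *m b^T + b *m a^T = 0 ->
  exists b1 b2 b3 : R, b1 ^+ 2 + b2 ^+ 2 + b3 ^+ 2 < 1 /\
   forall i, [/\ b i j1 = b3 * a i j2 - b2 * a i j3,
     b i j2 = b1 * a i j3 - b3 * a i j1 & b i j3 = b2 * a i j1 - b1 * a i j2].
Proof.
move=> hab hba.
have au : a \in unitmx.
  rewrite -row_free_unit -kermx_eq0; apply/eqP/row_matrixP=> k0.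
  rewrite row0; set c := row k0 _.
  have ca : c *m a = 0 by rewrite -row_mul mulmx_ker row0.
  have : sqn c = - sqn (c *m b).
    have -> : sqn c = (c *m 1%:M *m c^T) 0 0 by rewrite mulmx1.
    rewrite /sqn trmx_mul -hab mulmxBr mulmxBl !mulmxA ca !mul0mx sub0r.
    by rewrite [LHS]mxE.
  move=> h; apply: sqn_eq0; apply/eqP; rewrite eq_le sqn_ge0 andbT h.
  by rewrite oppr_le0 sqn_ge0.
pose K := invmx a *m b.
have aK : a *m K = b by rewrite /K mulmxA mulmxV // mul1mx.
have KT : K^T = - K.
  apply/eqP; rewrite -addr_eq0; apply/eqP.
  have h : a *m (K^T + K) *m a^T = 0.
    by rewrite mulmxDr mulmxDl aK -mulmxA -trmx_mul aK.
  have aTu : a^T \in unitmx by rewrite unitmx_tr.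
  by rewrite -(mulKmx au (K^T + K)) -(mulmxK aTu (a *m _)) h mul0mx mulmx0.
have Kij i j : K j i = - K i j.
  by have := congr1 (fun M : 'M[R]_3 => M i j) KT; rewrite !mxE.
have Kii i : K i i = 0 by have := Kij i i => h; lra.
have contr (x : 'rV[R]_3) : x != 0 -> sqn (x *m K) < sqn x.
  move=> x0; rewrite -subr_gt0.
  have -> : sqn x - sqn (x *m K) = sqn (x *m invmx a).
    have h : invmx a *m (invmx a)^T = 1%:M - K *m K^T.
      have aTu : a^T \in unitmx by rewrite unitmx_tr.
      rewrite -[X in X *m _]mulmx1 -hab mulmxBr mulmxBl !mulmxA mulVmx // mul1mx.
      have -> : K^T = b^T *m (invmx a)^T by rewrite trmx_mul.
      by rewrite /K !mulmxA trmx_inv mulmxV ?unitmx_tr // hab.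
    have sub00 (M N : 'M[R]_1) : (M - N) 0 0 = M 0 0 - N 0 0 by rewrite !mxE.
    have quad (M : 'M[R]_3) : (x *m M) *m (x *m M)^T = x *m (M *m M^T) *m x^T.
      by rewrite trmx_mul !mulmxA.
    by rewrite /sqn !quad h mulmxBr mulmxBl mulmx1 sub00.
  rewrite lt_def sqn_ge0 andbT; apply: contra x0 => /eqP/sqn_eq0 h.
  by rewrite -[x](mulmxKV au) h mul0mx.
clearbody K.
exists (K j3 j2), (K j1 j3), (K j2 j1); split; last first.
  move=> i; rewrite -aK !mxE !sum3 !Kii (Kij j2 j1) (Kij j3 j2) (Kij j1 j3).
  by split; ring.
pose b1 := K j3 j2; pose b2 := K j1 j3; pose b3 := K j2 j1.
rewrite -/b1 -/b2 -/b3.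
have xK (x : 'rV[R]_3) : sqn (x *m K) = (b3 * x 0 j2 - b2 * x 0 j3) ^+ 2
   + (b1 * x 0 j3 - b3 * x 0 j1) ^+ 2 + (b2 * x 0 j1 - b1 * x 0 j2) ^+ 2.
  rewrite sqnE sum3 !mxE !sum3 !Kii (Kij j2 j1) (Kij j3 j2) (Kij j1 j3) -/b1 -/b2 -/b3.
  by ring.
have [b12|b12] := eqVneq (b1 ^+ 2 + b2 ^+ 2) 0.
  have b10 : b1 = 0.
    by apply/eqP; rewrite -sqrf_eq0; apply/eqP; have := sqr_ge0 b1; have := sqr_ge0 b2; lra.
  have b20 : b2 = 0.
    by apply/eqP; rewrite -sqrf_eq0; apply/eqP; have := sqr_ge0 b1; have := sqr_ge0 b2; lra.
  have := contr (delta_mx 0 j1); rewrite xK sqnE sum3 !mxE /= b10 b20.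
  set nz := _ != 0; have : nz.
    by apply/eqP => /rowP/(_ j1); rewrite !mxE /= => /eqP; rewrite oner_eq0.
  by move=> -> /(_ isT); rewrite ?expr0n /=; nra.
(* Here x K = x cross beta, and this x is orthogonal to beta, so the contraction bound reads |x|^2
   |beta|^2 < |x|^2. It vanishes when b1 = b2 = 0, whence the separate use of the first axis
   above. *)
pose x : 'rV[R]_3 := \row_k (match val k with 0 => b2 | 1 => - b1 | _ => 0 end).
have x0 : x != 0.
  apply: contra b12 => /eqP x0.
  have := congr1 (fun u : 'rV[R]_3 => u 0 j1) x0; have := congr1 (fun u : 'rV[R]_3 => u 0 j2) x0.
  rewrite !mxE /= => /eqP; rewrite oppr_eq0 => /eqP -> ->.
  by rewrite expr0n addr0.
have := contr _ x0; rewrite xK sqnE sum3 !mxE /= => h.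
have s0 : 0 < b1 ^+ 2 + b2 ^+ 2 by rewrite lt_def b12 addr_ge0 ?sqr_ge0.
rewrite -(ltr_pM2l s0); nra.
Qed.
End BoostParameter.

(** * From a complex rotation to an orthonormal tetrad *)

Section TetradOfOrthogonal.
Variable R : rcfType.
Local Notation C := (R[i]).
Variables (g : 'M[R]_4) (e : 'I_4 -> vec R) (O : 'M[C]_3).
Hypothesis onb : orthonormal_frame g e.
Hypothesis OO : O *m O^T = 1%:M.

Local Notation J := (frameJ g e).
Local Notation o := (orientation g e).

(* A complex orthogonal O acts on self-dual forms as a Lorentz transformation:
   the timelike leg v is the observer for whom the electric parts of all the
   rotated forms are real, and these real electric parts give the spatial legs. *)
Definition sdrotate k : ctensor2 R := fun a b => \sum_(l < 3) O k l * sdbasis g e l a b.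

Lemma ev2_sum3 (c : 'I_3 -> C) (F : 'I_3 -> ctensor2 R) s t :
  ev2 (fun a b => \sum_(l < 3) c l * F l a b) s t = \sum_(l < 3) c l * ev2 (F l) s t.
Proof.
rewrite (eq_ev2 (Y := fun a b => 1 * (c j1 * F j1 a b + c j2 * F j2 a b) + c j3 * F j3 a b)).
  by rewrite !ev2_lin sum3 mul1r.
by move=> a b; rewrite sum3 mul1r.
Qed.

Lemma sdrotate_sdual k : sdual g (sdrotate k).
Proof.
have sF l := sdbasis_sdual onb l.
split=> a b.
  rewrite /sdrotate -sumrN; apply: eq_bigr => l _.
  by rewrite ((sF l).1 a b) mulrN.
rewrite (@eq_cdual R g (sdrotate k) (fun a b => 1 * (O k j1 * sdbasis g e j1 a b
  + O k j2 * sdbasis g e j2 a b) + O k j3 * sdbasis g e j3 a b)); last first.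
  by move=> a' b'; rewrite /sdrotate sum3 mul1r.
by rewrite !cdual_lin !(sF _).2 /sdrotate sum3; ring.
Qed.

Definition of_coord (c : 'I_4 -> R) : vec R := fun p => \sum_(j < 4) c j * e j p.

Lemma coord_of_coord c j : frame_coord g e (of_coord c) j = c j.
Proof.
have -> : frame_coord g e (of_coord c) j = sgn j * \sum_i c i * gdot g (e j) (e i).
  rewrite /frame_coord; congr (_ * _); rewrite /gdot /of_coord.
  under [RHS]eq_bigr do rewrite mulr_sumr.
  rewrite [RHS]exchange_big; apply: eq_bigr => a _ /=.
  under [RHS]eq_bigr do rewrite mulr_sumr.
  rewrite [RHS]exchange_big; apply: eq_bigr => b _ /=.
  by rewrite mulr_sumr; apply: eq_bigr => i _; ring.
rewrite (bigD1 j) //= big1 ?addr0.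
  by rewrite onb etaE eqxx mulrCA sgn_sqr mulr1.
by move=> i ij; rewrite onb etaE eq_sym (negbTE ij) mulr0.
Qed.

Lemma ev2_coord_l X s t : antisym2 X ->
  ev2 X s t = \sum_(j < 4) cx (frame_coord g e s j) * ev2 X (e j) t.
Proof.
move=> aX; rewrite (antisym2_ev2 t s aX) (ev2_coord onb) -sumrN.
by apply: eq_bigr => j _; rewrite (antisym2_ev2 (e j) t aX) mulrN opprK.
Qed.

Lemma tetrad_of_orthogonal : exists v x y z, orthonormal_tetrad g v x y z /\
  forall k a b, sdbasis g (tetrad_vec v x y z) k a b = \sum_(l < 3) O k l * sdbasis g e l a b.
Proof.
pose a : 'M[R]_3 := \matrix_(i, j) complex.Re (O i j).
pose b : 'M[R]_3 := \matrix_(i, j) complex.Im (O i j).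
have OE i j : O i j = cx (a i j) + 'i%C * cx (b i j).
  by rewrite !mxE [LHS]complexE mulrC.
have ortho i j : \sum_k O i k * O j k = (i == j)%:R.
  have := congr1 (fun M : 'M[C]_3 => M i j) OO; rewrite !mxE => <-.
  by apply: eq_bigr => k _; rewrite mxE.
have orthoE i j : (\sum_k (a i k * a j k - b i k * b j k) = (i == j)%:R)
   /\ (\sum_k (a i k * b j k + b i k * a j k) = 0).
  have h := ortho i j.
  have : cx (\sum_k (a i k * a j k - b i k * b j k))
    + 'i%C * cx (\sum_k (a i k * b j k + b i k * a j k)) = cx ((i == j)%:R) + 'i%C * cx 0.
    rewrite rmorph_nat rmorph0 mulr0 addr0 -h !raddf_sum mulr_sumr -big_split.
    apply: eq_bigr => k _ /=; rewrite !OE; have := @sqr_i R => hi; ring: hi.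
  by move/eqP; rewrite eq_complex /= => /andP[/eqP h1 /eqP h2]; split; lra.
have [b1 [b2 [b3 [b_lt1 bE]]]] : exists b1 b2 b3 : R, b1 ^+ 2 + b2 ^+ 2 + b3 ^+ 2 < 1 /\
   forall i, [/\ b i j1 = b3 * a i j2 - b2 * a i j3,
     b i j2 = b1 * a i j3 - b3 * a i j1 & b i j3 = b2 * a i j1 - b1 * a i j2].
  have subE (M N : 'M[R]_3) i j : (M - N) i j = M i j - N i j by rewrite !mxE.
  have addE (M N : 'M[R]_3) i j : (M + N) i j = M i j + N i j by rewrite !mxE.
  have mulE (M N : 'M[R]_3) i j : (M *m N^T) i j = \sum_k M i k * N j k.
    by rewrite mxE; apply: eq_bigr => k _; rewrite mxE.
  apply: boost_parameter; apply/matrixP=> i j; rewrite [RHS]mxE.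
    by rewrite subE !mulE -sumrB -(orthoE i j).1.
  by rewrite addE !mulE -big_split -[RHS](orthoE i j).2.
(* The Lorentz factor of beta. The new timelike leg will be gam (e_0 - o beta), the sign o
   compensating the one in J = i o. *)
pose gam := (Num.sqrt (1 - (b1 ^+ 2 + b2 ^+ 2 + b3 ^+ 2)))^-1.
have gamE : gam ^+ 2 * (1 - (b1 ^+ 2 + b2 ^+ 2 + b3 ^+ 2)) = 1.
  by rewrite /gam exprVn sqr_sqrtr ?mulVf ?subr_ge0 ?(ltW b_lt1) // gt_eqF // subr_gt0.
have o2 : o ^+ 2 = 1 := orientation_sqr onb.
have i2E := @sqr_i R.
pose tc (j : 'I_4) : R := gam * match val j with 0 => 1 | 1 => - o * b1 | 2 => - o * b2 | _ => - o * b3 end.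
pose v := of_coord tc.
have tc_unit : tc i0 ^+ 2 - tc i1 ^+ 2 - tc i2 ^+ 2 - tc i3 ^+ 2 = 1.
  by rewrite /tc /= -[RHS]gamE; ring: o2.
pose xi i m : R := complex.Re (ev2 (sdrotate i) (e m) v).
have xiE i m : ev2 (sdrotate i) (e m) v = cx (xi i m).
  rewrite /xi; set w := ev2 _ _ _; suff h : complex.Im w = 0.
    by rewrite [LHS]complexE h mulr0 addr0.
  have -> : w = \sum_(l < 3) O i l * \sum_(j < 4) cx (tc j) * sdtab J l m j.
    rewrite /w ev2_sum3; apply: eq_bigr => l _; rewrite (ev2_sdbasis_coord onb).
    by congr (_ * _); apply: eq_bigr => j _; rewrite coord_of_coord.
  have [h1 h2 h3] := bE i.
  (* The real part of the component. The imaginary part is proportional to b_i - a_i cross beta for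
     spatial m and to beta . b_i for m = 0; both vanish by [bE]. *)
  pose E (m' : 'I_4) : R := 2^-1 * gam * match val m' with
     | 0 => o * (b1 * a i j1 + b2 * a i j2 + b3 * a i j3)
     | 1 => a i j1 + b3 * b i j2 - b2 * b i j3
     | 2 => a i j2 + b1 * b i j3 - b3 * b i j1
     | _ => a i j3 + b2 * b i j1 - b1 * b i j2 end.
  have -> : \sum_(l < 3) O i l * \sum_(j < 4) cx (tc j) * sdtab J l m j = cx (E m).
    rewrite sum3 !sum4 !OE h1 h2 h3 /E /tc /frameJ.
    have o2C : cx o ^+ 2 = 1 by rewrite -rmorphXn /= o2.
    by elim/ord4_ind: m {w}; rewrite /sdtab /= ?h1 ?h2 ?h3; field: i2E o2C.
  by [].
have tabE i m : cx (xi i m) = \sum_(l < 3) O i l * \sum_(j < 4) cx (tc j) * sdtab J l m j.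
  rewrite -xiE ev2_sum3; apply: eq_bigr => l _; rewrite (ev2_sdbasis_coord onb).
  by congr (_ * _); apply: eq_bigr => j _; rewrite coord_of_coord.
clearbody xi.
have J2 : J ^+ 2 = -1 := frameJ_sqr onb.
have tcC : cx (tc i0) ^+ 2 = 1 + (cx (tc i1) ^+ 2 + cx (tc i2) ^+ 2 + cx (tc i3) ^+ 2).
  have h : tc i0 ^+ 2 = 1 + (tc i1 ^+ 2 + tc i2 ^+ 2 + tc i3 ^+ 2) by rewrite -tc_unit; ring.
  by rewrite -!rmorphXn /= h !(rmorphD, rmorph1).
(* For self-dual X and Y, the contraction X_ma Y^m_b has symmetric part proportional to g_ab; at the
   unit vector [v] only O O^T = 1 is left. *)
have xi_ortho i j : \sum_m sgn m * (xi i m * xi j m) = - 4^-1 * (i == j)%:R.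
  have : \sum_m cx (sgn m) * (cx (xi i m) * cx (xi j m)) = - 4^-1 * (i == j)%:R.
    rewrite -ortho sum4 !tabE !sum3 !sum4 !sgnE /sdtab /=.
    by clear - J2 tcC; field: J2 tcC.
  move=> h; have : cx (\sum_m sgn m * (xi i m * xi j m)) = cx (- 4^-1 * (i == j)%:R).
    rewrite raddf_sum rmorphM rmorphN fmorphV !rmorph_nat -h.
    by apply: eq_bigr => m _ /=; ring.
  by move=> [].
have xi_v i : \sum_m tc m * xi i m = 0.
  have h : \sum_m cx (tc m) * cx (xi i m) = 0.
    by rewrite sum4 !tabE !sum3 !sum4 /sdtab /=; field.
  have : cx (\sum_m tc m * xi i m) = cx 0.
    by rewrite rmorph0 -[RHS]h raddf_sum; apply: eq_bigr => m _ /=; ring.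
  by move=> [].
(* The sign raises the index, and -2 normalises so that O = 1 gives back the original spatial
   legs. *)
pose X i : vec R := of_coord (fun m => - 2 * sgn m * xi i m).
exists v, (X j1), (X j2), (X j3).
have XE i : tetrad_vec v (X j1) (X j2) (X j3) (lift ord0 i) = X i.
  by elim/ord3_ind: i; rewrite !liftE.
have XX i j : gdot g (X i) (X j) = - (i == j)%:R.
  rewrite (gdot_coord onb) (eq_bigr (fun m => 4 * (sgn m * (xi i m * xi j m)))).
    by rewrite -mulr_sumr xi_ortho; field.
  by move=> m _; rewrite !coord_of_coord; have := sgn_sqr R m => h; ring: h.
have vX i : gdot g v (X i) = 0.
  rewrite (gdot_coord onb) (eq_bigr (fun m => - 2 * (tc m * xi i m))).
    by rewrite -mulr_sumr xi_v mulr0.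
  by move=> m _; rewrite !coord_of_coord; have := sgn_sqr R m => h; ring: h.
have Xv i : gdot g (X i) v = 0.
  by rewrite -[RHS](vX i) (gdot_coord onb (X i)) (gdot_coord onb v); apply: eq_bigr => m _; ring.
have vv : gdot g v v = 1.
  by rewrite (gdot_coord onb) sum4 !sgnE !coord_of_coord -[RHS]tc_unit; ring.
have onb' : orthonormal_frame g (tetrad_vec v (X j1) (X j2) (X j3)).
  move=> i j; rewrite [RHS]mxE.
  by elim/ord4_ind: i; elim/ord4_ind: j; rewrite /tetrad_vec /= ?vv ?vX ?Xv ?XX /= ?oppr0.
split=> // k a' b'.
rewrite -/(sdrotate k a' b') (sdual_basis onb' (sdrotate_sdual k)) sum3 !XE.
(* A self-dual form is determined by its electric components, so these values identify the rotated
   form with the k-th basic form of the new tetrad. *)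
have half i : ev2 (sdrotate k) v (X i) = - 2^-1 * (k == i)%:R.
  have aS := (sdrotate_sdual k).1.
  rewrite (antisym2_ev2 _ _ aS) (ev2_coord_l _ _ aS).
  have := XX k i; rewrite (gdot_coord onb) => /(congr1 (fun r : R => cx r)).
  rewrite raddf_sum rmorphN rmorph_nat => h.
  have -> : (k == i)%:R = - - (k == i)%:R :> C by rewrite opprK.
  rewrite -h mulrNN mulr_sumr -sumrN; apply: eq_bigr => m _.
  rewrite xiE !coord_of_coord !rmorphM /=.
  have := congr1 (fun r : R => cx r) (sgn_sqr R m); rewrite rmorphM rmorph1 => s2.
  by field: s2.
by rewrite /= (half j1) (half j2) (half j3); elim/ord3_ind: k {half} => /=; field.
Qed.
End TetradOfOrthogonal.

(** * The Weyl tensor as a complex symmetric matrix *)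

Section WeylComponents.
Variable R : rcfType.
Local Notation C := (R[i]).
Variables (g : 'M[R]_4) (Cw : tensor4 R) (e : 'I_4 -> vec R).
Hypotheses (onb : orthonormal_frame g e) (wC : weyl g Cw).

Local Notation J := (frameJ g e).
Local Notation o := (orientation g e).

Let W i j k l : R := \sum_(a < 4) \sum_(b < 4) \sum_(c < 4) \sum_(d < 4)
  Cw a b c d * (e i a * e j b * (e k c * e l d)).

Let WN12 i j k l : W j i k l = - W i j k l.
Proof.
rewrite /W exchange_big -sum4N; do 4!apply: eq_bigr => ? _.
by rewrite wC.1; ring.
Qed.

Let WN34 i j k l : W i j l k = - W i j k l.
Proof.
rewrite /W -sum4N; do 2!apply: eq_bigr => ? _; rewrite exchange_big.
by do 2!apply: eq_bigr => ? _; rewrite wC.2.1; ring.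
Qed.

Let exchange_pairs (F : 'I_4 -> 'I_4 -> 'I_4 -> 'I_4 -> R) :
  \sum_a \sum_b \sum_c \sum_d F a b c d = \sum_c \sum_d \sum_a \sum_b F a b c d.
Proof.
under eq_bigr do rewrite exchange_big /=.
rewrite exchange_big; apply: eq_bigr => c _ /=.
under eq_bigr do rewrite exchange_big /=.
by rewrite exchange_big; apply: eq_bigr.
Qed.

Let Wsym i j k l : W k l i j = W i j k l.
Proof.
rewrite /W exchange_pairs; do 4!apply: eq_bigr => ? _.
by rewrite wC.2.2.1; ring.
Qed.

Let cycle3 (F : 'I_4 -> 'I_4 -> 'I_4 -> R) :
  \sum_b \sum_c \sum_d F b c d = \sum_d \sum_b \sum_c F b c d.
Proof.
by under eq_bigr do rewrite exchange_big /=; rewrite exchange_big.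
Qed.

Let Wbianchi i j k l : W i j k l + W i k l j + W i l j k = 0.
Proof.
have E2 : W i k l j = \sum_(a < 4) \sum_(b < 4) \sum_(c < 4) \sum_(d < 4)
    Cw a c d b * (e i a * e j b * (e k c * e l d)).
  apply: eq_bigr => a _; rewrite cycle3; do 3!apply: eq_bigr => ? _; ring.
have E3 : W i l j k = \sum_(a < 4) \sum_(b < 4) \sum_(c < 4) \sum_(d < 4)
    Cw a d b c * (e i a * e j b * (e k c * e l d)).
  apply: eq_bigr => a _; rewrite -cycle3; do 3!apply: eq_bigr => ? _; ring.
rewrite E2 E3 -!big_split big1 // => a _; rewrite -!big_split big1 // => b _.
rewrite -!big_split big1 // => c _; rewrite -!big_split big1 // => d _ /=.
by rewrite -!mulrDl wC.2.2.2.1 mul0r.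
Qed.

Let Wtrace j l : \sum_(i < 4) sgn i * W i j i l = 0.
Proof.
transitivity (\sum_(b < 4) \sum_(d < 4)
  (\sum_(a < 4) \sum_(c < 4) ginv g a c * Cw a b c d) * (e j b * e l d)); last first.
  by rewrite big1 // => b _; rewrite big1 // => d _; rewrite wC.2.2.2.2 mul0r.
transitivity (\sum_(b < 4) \sum_(d < 4) \sum_(a < 4) \sum_(c < 4) \sum_(i < 4)
  sgn i * (Cw a b c d * (e i a * e j b * (e i c * e l d)))); last first.
  apply: eq_bigr => b _; apply: eq_bigr => d _; rewrite mulr_suml; apply: eq_bigr => a _.
  rewrite mulr_suml; apply: eq_bigr => c _; rewrite (ginv_frame onb) !mulr_suml.
  by apply: eq_bigr => i _; ring.
have ex (G : 'I_4 -> 'I_4 -> 'I_4 -> 'I_4 -> 'I_4 -> R) :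
  \sum_b \sum_d \sum_a \sum_c \sum_i G b d a c i
  = \sum_i \sum_b \sum_d \sum_a \sum_c G b d a c i.
  rewrite [RHS]exchange_big; apply: eq_bigr => b _.
  rewrite [RHS]exchange_big; apply: eq_bigr => d _.
  rewrite [RHS]exchange_big; apply: eq_bigr => a _.
  by rewrite [RHS]exchange_big.
rewrite ex; apply: eq_bigr => i _; rewrite /W exchange_pairs.
under [RHS]eq_bigr do rewrite exchange_big /=.
do 4!(rewrite mulr_sumr; apply: eq_bigr => ? _); ring.
Qed.

(** ([ka k], [kb k]) is the spatial index pair dual to (0, k + 1), in cyclic order. *)
Let ka (k : 'I_3) : 'I_4 := match val k with 0 => i2 | 1 => i3 | _ => i1 end.
Let kb (k : 'I_3) : 'I_4 := match val k with 0 => i3 | 1 => i1 | _ => i2 end.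
Local Notation succ k := (lift ord0 k).

(** Left and right duals of a trace-free tensor with these symmetries agree; in components this is
    linear algebra over the ten trace equations and the pair symmetries. *)
Let W_dual k l :
  W i0 (succ k) (ka l) (kb l) = W (ka k) (kb k) i0 (succ l) /\
  W (ka k) (kb k) (ka l) (kb l) = - W i0 (succ k) i0 (succ l).
Proof.
have oppr_eq (r : R) : r = - r -> r = 0 by move=> h; lra.
have W11 i k' l' : W i i k' l' = 0 by apply/oppr_eq/WN12.
have W22 i k' l' : W k' l' i i = 0 by apply/oppr_eq/WN34.
have n12 i j k' l' : W j i k' l' = - W i j k' l' := WN12 i j k' l'.
have n34 i j k' l' : W k' l' j i = - W k' l' i j := WN34 k' l' i j.
have cE := (W11, W22,
  n12 i0 i1, n12 i0 i2, n12 i0 i3, n12 i2 i3, n12 i3 i1, n12 i1 i2,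
  n34 i0 i1, n34 i0 i2, n34 i0 i3, n34 i2 i3, n34 i3 i1, n34 i1 i2).
have y1 := Wsym i0 i1 i0 i2.
have y2 := Wsym i0 i1 i0 i3.
have y3 := Wsym i0 i1 i2 i3.
have y4 := Wsym i0 i1 i3 i1.
have y5 := Wsym i0 i1 i1 i2.
have y6 := Wsym i0 i2 i0 i3.
have y7 := Wsym i0 i2 i2 i3.
have y8 := Wsym i0 i2 i3 i1.
have y9 := Wsym i0 i2 i1 i2.
have y10 := Wsym i0 i3 i2 i3.
have y11 := Wsym i0 i3 i3 i1.
have y12 := Wsym i0 i3 i1 i2.
have y13 := Wsym i2 i3 i3 i1.
have y14 := Wsym i2 i3 i1 i2.
have y15 := Wsym i3 i1 i1 i2.
have t1 := Wtrace i0 i0.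
have t2 := Wtrace i0 i1.
have t3 := Wtrace i0 i2.
have t4 := Wtrace i0 i3.
have t5 := Wtrace i1 i1.
have t6 := Wtrace i1 i2.
have t7 := Wtrace i1 i3.
have t8 := Wtrace i2 i2.
have t9 := Wtrace i2 i3.
have t10 := Wtrace i3 i3.
rewrite !sum4 !sgnE ?cE ?(mulr0,mul1r,add0r,addr0,mulN1r,opprK) in t1 t2 t3 t4 t5 t6 t7 t8 t9 t10.
rewrite /ka /kb; elim/ord3_ind: k; elim/ord3_ind: l; rewrite !liftE /= ?cE.
all: split; lra.
Qed.

(* The symmetric matrix A with C^+ = sum_kl A_kl F^k F^l; Qmat_entry below shows
   that E + i B = - conj(A) / 2 in the same frame. *)
Definition sdcoef : 'M[C]_3 :=
  \matrix_(k, l) (2 * (cx (W i0 (succ k) i0 (succ l)) - J * cx (W (ka k) (kb k) i0 (succ l)))).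

Let ev2_sd4 k (c d : 'I_4) : ev2 (fun a b => sd4 g Cw a b c d) (e i0) (e (succ k))
  = 2^-1 * ev2 (fun a b => cx (Cw a b c d)) (e i0) (e (succ k))
    + - (J / 2) * ev2 (fun a b => cx (Cw a b c d)) (e (ka k)) (e (kb k)).
Proof.
pose X : ctensor2 R := fun a b => cx (Cw a b c d).
have aX : antisym2 X by move=> a b; rewrite /X wC.1 rmorphN.
have [t1 t2 t3 _] := cdual_frame_table onb aX.
rewrite (@eq_ev2 R _ (fun a b => 2^-1 * X a b + (- 'i%C / 2) * cdual g X a b)); last first.
  move=> a b; rewrite /sd4 -/(dual2 g (fun p q => Cw p q c d) a b) dual2_cdual /X; ring.
rewrite ev2_lin -/X; congr (_ + _); rewrite /frameJ.
by elim/ord3_ind: k; rewrite !liftE ?t1 ?t2 ?t3; ring.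
Qed.

Let ev2_ev2 i j k l :
  ev2 (fun c d => ev2 (fun a b => cx (Cw a b c d)) (e i) (e j)) (e k) (e l) = cx (W i j k l).
Proof.
rewrite /W exchange_pairs raddf_sum; apply: eq_bigr => c _.
rewrite raddf_sum; apply: eq_bigr => d _; rewrite -mulrA raddf_sum mulr_suml.
apply: eq_bigr => a _; rewrite raddf_sum mulr_suml; apply: eq_bigr => b _ /=; ring.
Qed.

Let ev2_sd4_right k i j :
  ev2 (fun c d => ev2 (fun a b => sd4 g Cw a b c d) (e i0) (e (succ k))) (e i) (e j)
  = 2^-1 * cx (W i0 (succ k) i j) + - (J / 2) * cx (W (ka k) (kb k) i j).
Proof. by rewrite (eq_ev2 _ _ (ev2_sd4 k)) ev2_lin !ev2_ev2. Qed.

(** The self-dual part is expanded in its first index pair; by [W_dual] the coefficients are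
    self-dual in the second pair and expand again. *)
Lemma weyl_sdcoef a b c d : sd4 g Cw a b c d
  = \sum_k \sum_l sdcoef k l * sdbasis g e k a b * sdbasis g e l c d.
Proof.
have sX : sdual g (fun a b => sd4 g Cw a b c d).
  by apply: (sd2_sdual onb (F := fun p q => Cw p q c d)) => p q; rewrite wC.1.
rewrite (sdual_basis onb sX) mulr_sumr; apply: eq_bigr => k _.
pose Y : ctensor2 R := fun c d => ev2 (fun a b => sd4 g Cw a b c d) (e i0) (e (succ k)).
rewrite -[ev2 _ _ _]/(Y c d).
have aY : antisym2 Y.
  move=> p q; have flip i j : ev2 (fun a b => cx (Cw a b q p)) (e i) (e j)
     = - ev2 (fun a b => cx (Cw a b p q)) (e i) (e j).
    by rewrite -mulN1r -ev2Z; apply: eq_ev2 => r s; rewrite wC.2.1 rmorphN mulN1r.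
  by rewrite /Y !ev2_sd4 !flip; ring.
have J2 := frameJ_sqr onb.
have fY : frame_sdual g e Y.
  rewrite /frame_sdual /Y !ev2_sd4_right.
  have [[a1 b1] [[a2 b2] [a3 b3]]] := (W_dual k j1, (W_dual k j2, W_dual k j3)).
  rewrite /= !liftE in a1 b1 a2 b2 a3 b3.
  by split; [rewrite a1 b1 | rewrite a2 b2 | rewrite a3 b3]; ring: J2.
rewrite (frame_sdual_basis onb aY fY) !(mulr_sumr, mulr_suml); apply: eq_bigr => l _.
by rewrite /Y ev2_sd4_right mxE; field.
Qed.

Lemma sdcoef_sym : sdcoef^T = sdcoef.
Proof.
apply/matrixP=> k l; rewrite !mxE; congr (2 * (cx _ - J * cx _)); first exact: Wsym.
by rewrite -(W_dual k l).1 Wsym.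
Qed.

(** The part without J vanishes by the metric trace, the part with J by the cyclic identity. *)
Lemma sdcoef_trace : \tr sdcoef = 0.
Proof.
rewrite /mxtrace sum3 !mxE !liftE /ka /kb /=.
have t := Wtrace i0 i0; have b := Wbianchi i0 i1 i2 i3.
rewrite sum4 !sgnE in t.
have W0 : W i0 i0 i0 i0 = 0 by have := WN12 i0 i0 i0 i0 => h; lra.
have t' : W i0 i1 i0 i1 + W i0 i2 i0 i2 + W i0 i3 i0 i3 = 0.
  have := (WN12 i0 i1 i0 i1, WN12 i0 i2 i0 i2, WN12 i0 i3 i0 i3) => -[[h1 h2] h3].
  have := (WN34 i1 i0 i0 i1, WN34 i2 i0 i0 i2, WN34 i3 i0 i0 i3) => -[[h4 h5] h6].
  lra.
have b' : W i2 i3 i0 i1 + W i3 i1 i0 i2 + W i1 i2 i0 i3 = 0.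
  by rewrite -b (Wsym i0 i1) (Wsym i0 i2) (Wsym i0 i3).
transitivity (2 * (cx (W i0 i1 i0 i1 + W i0 i2 i0 i2 + W i0 i3 i0 i3)
  - J * cx (W i2 i3 i0 i1 + W i3 i1 i0 i2 + W i1 i2 i0 i3))); first by ring.
by rewrite t' b' rmorph0; ring.
Qed.

Let ev2_elec (X : tensor4 R) s t u :
  \sum_(a < 4) \sum_(b < 4) cx (elec X t a b) * cx (s a) * cx (u b)
  = ev2 (fun d b => ev2 (fun a c => cx (X a c d b)) s t) t u.
Proof.
transitivity (\sum_(d < 4) \sum_(b < 4) \sum_(a < 4) \sum_(c < 4)
   cx (X a c d b) * cx (s a) * cx (t c) * cx (t d) * cx (u b)); last first.
  apply: eq_bigr => d _; apply: eq_bigr => b _; rewrite -mulrA mulr_suml.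
  apply: eq_bigr => a _; rewrite mulr_suml; apply: eq_bigr => c _; by rewrite !mulrA.
transitivity (\sum_(a < 4) \sum_(b < 4) \sum_(d < 4) \sum_(c < 4)
   cx (X a c d b) * cx (s a) * cx (t c) * cx (t d) * cx (u b)).
  apply: eq_bigr => a _; apply: eq_bigr => b _; rewrite /elec exchange_big.
  rewrite raddf_sum !mulr_suml; apply: eq_bigr => d _.
  by rewrite raddf_sum !mulr_suml; apply: eq_bigr => c _ /=; ring.
rewrite exchange_big; under eq_bigr do rewrite exchange_big /=.
by rewrite exchange_big.
Qed.

(** The conjugate arises because E + i B carries + i where the self-dual part carries - i; the minus
    sign is that of C_k00l = - C_0k0l. *)
Lemma Qmat_entry k l :
  \sum_(a < 4) \sum_(b < 4)
    (cx (elec Cw (e i0) a b) + 'i%C * cx (elec (dual4 g Cw) (e i0) a b))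
      * cx (e (succ k) a) * cx (e (succ l) b)
  = - 2^-1 * (sdcoef k l)^*.
Proof.
transitivity (\sum_(a < 4) \sum_(b < 4)
    cx (elec Cw (e i0) a b) * cx (e (succ k) a) * cx (e (succ l) b)
  + 'i%C * \sum_(a < 4) \sum_(b < 4)
    cx (elec (dual4 g Cw) (e i0) a b) * cx (e (succ k) a) * cx (e (succ l) b)).
  rewrite mulr_sumr -big_split; apply: eq_bigr => a _.
  by rewrite mulr_sumr -big_split; apply: eq_bigr => b _ /=; ring.
rewrite !ev2_elec ev2_ev2 WN12.
have dualE d b : ev2 (fun a c => cx (dual4 g Cw a c d b)) (e (succ k)) (e i0)
  = - cx o * ev2 (fun a c => cx (Cw a c d b)) (e (ka k)) (e (kb k)) * -1 * -1.
  pose X : ctensor2 R := fun a c => cx (Cw a c d b).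
  have aX : antisym2 X by move=> a c; rewrite /X wC.1 rmorphN.
  rewrite (@eq_ev2 R _ (cdual g X)); last first.
    move=> a c; exact: (dual2_cdual g (fun p q => Cw p q d b)).
  rewrite (antisym2_ev2 _ _ (@cdual_antisym R g X)).
  have [t1 t2 t3 _] := cdual_frame_table onb aX.
  by rewrite -/X; elim/ord3_ind: k; rewrite !liftE ?t1 ?t2 ?t3; ring.
rewrite (eq_ev2 _ _ dualE).
rewrite (@eq_ev2 R _ (fun d b => - cx o * ev2 (fun a c => cx (Cw a c d b)) (e (ka k)) (e (kb k))));
  last by move=> d b; ring.
rewrite ev2Z ev2_ev2 mxE.
have -> : (2 * (cx (W i0 (succ k) i0 (succ l)) - J * cx (W (ka k) (kb k) i0 (succ l))))^*
  = 2 * (cx (W i0 (succ k) i0 (succ l)) - J^* * cx (W (ka k) (kb k) i0 (succ l))).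
  rewrite -[cx (W i0 _ _ _) in RHS]conjc_real -[cx (W (ka _) _ _ _) in RHS]conjc_real; ring.
by rewrite frameJ_conj /frameJ rmorphN; field.
Qed.

End WeylComponents.

(** * Canonical tetrads of a type I Weyl tensor *)

Section Existence.
Variable R : rcfType.
Local Notation C := (R[i]).
Variables (g : 'M[R]_4) (Cw : tensor4 R).
Hypotheses (wC : weyl g Cw) (typeI : petrov_typeI g Cw).

Lemma petrov_form_exists : exists v x y z (s1 s2 s3 : C),
  [/\ petrov_canonical_form g Cw v x y z s1 s2 s3, s1 != s2, s2 != s3 & s3 != s1].
Proof.
have [v [x [y [z [onb [l1 [l2 [l3 [l12 l13 l23 [r1 r2 r3]]]]]]]]]] := typeI.
pose e := tetrad_vec v x y z; rewrite -/(orthonormal_frame g e) in onb.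
pose Q := Qmat g Cw v x y z; pose A := sdcoef g Cw e.
have AQ : A = -2 *: map_mx Num.conj Q.
  have QE k l : Q k l = - 2^-1 * (A k l)^* by rewrite mxE; exact: Qmat_entry.
  apply/matrixP=> k l; rewrite [RHS]mxE [map_mx _ _ _ _]mxE QE.
  rewrite rmorphM /= conjCK rmorphN fmorphV rmorph_nat; by field.
(* The eigenvalues of A = -2 conj(Q); they become the coefficients of the canonical form. *)
pose m (i : 'I_3) : C := -2 * (match val i with 0 => l1 | 1 => l2 | _ => l3 end)^*.
have m_inj : injective m.
  have n2 : -2 != 0 :> C by rewrite oppr_eq0 pnatr_eq0.
  move=> i j /(mulfI n2)/(can_inj (@conjCK _)).
  by elim/ord3_ind: i; elim/ord3_ind: j => //= /eqP;
    rewrite ?(negbTE l12) ?(negbTE l13) ?(negbTE l23) // eq_sym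
      ?(negbTE l12) ?(negbTE l13) ?(negbTE l23).
have m_eigen i : eigenvalue A (m i).
  have /eigenvalueP[w wQ w0] : eigenvalue Q (match val i with 0 => l1 | 1 => l2 | _ => l3 end).
    by rewrite eigenvalue_root_char; elim/ord3_ind: i.
  apply/eigenvalueP; exists (map_mx Num.conj w); last by rewrite map_mx_eq0.
  by rewrite AQ -scalemxAr -map_mxM wQ map_mxZ scalerA.
have [O [OO AE]] := orthogonal_diagonalization (sdcoef_sym onb wC) m_inj m_eigen.
have {}AE : A = O^T *m diag_mx (\row_i m i) *m O := AE.
have trA : \tr A = 0 := sdcoef_trace onb wC.
have sdA a b c d : sd4 g Cw a b c d
  = \sum_k \sum_l A k l * sdbasis g e k a b * sdbasis g e l c d by exact: weyl_sdcoef.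
have [v' [x' [y' [z' [onb' FE]]]]] := tetrad_of_orthogonal onb OO.
exists v', x', y', z', (m j1), (m j2), (m j3).
split; try by rewrite (inj_eq m_inj).
split=> //; split.
  move: trA; rewrite AE mxtrace_mulC mulmxA OO mul1mx.
  by rewrite mxtrace_diag sum3 !mxE.
move=> a b c d; rewrite sdA.
have AkE k l : A k l = \sum_i m i * (O i k * O i l).
  rewrite AE mxE; apply: eq_bigr => i _; rewrite mul_mx_diag !mxE; ring.
transitivity (\sum_i m i * sdbasis g (tetrad_vec v' x' y' z') i a b
   * sdbasis g (tetrad_vec v' x' y' z') i c d); last by rewrite sum3 /sdbasis !liftE.
rewrite !sum3 !AkE !FE !sum3; ring.
Qed.

(** Reversing the timelike leg changes the sign of all three basic forms, which enter quadratically;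
    this makes the leg future-pointing at no cost. *)
Lemma petrov_form_opp v x y z s1 s2 s3 :
  petrov_canonical_form g Cw v x y z s1 s2 s3 ->
  petrov_canonical_form g Cw (fun a => - v a) x y z s1 s2 s3.
Proof.
move=> [onb [s0 sdE]].
have gNl s t : gdot g (fun a => - s a) t = - gdot g s t.
  by rewrite /gdot -sumrN; apply: eq_bigr => a _; rewrite -sumrN; apply: eq_bigr => b _; ring.
have gNr s t : gdot g s (fun a => - t a) = - gdot g s t.
  by rewrite /gdot -sumrN; apply: eq_bigr => a _; rewrite -sumrN; apply: eq_bigr => b _; ring.
have wN t a b : wedge g (fun a => - v a) t a b = - wedge g v t a b.
  have lN c : lower g (fun a => - v a) c = - lower g v c.
    by rewrite /lower -sumrN; apply: eq_bigr => d _; rewrite mulrN.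
  by rewrite /wedge !lN; ring.
have sdN t a b : sd2 g (wedge g (fun a => - v a) t) a b = - sd2 g (wedge g v t) a b.
  have dN : dual2 g (wedge g (fun a => - v a) t) a b = - dual2 g (wedge g v t) a b.
    by rewrite /dual2 -mulrN; congr (_ * _); do 4!(rewrite -sumrN; apply: eq_bigr => ? _);
      rewrite wN; ring.
  by rewrite /sd2 wN dN; ring.
split; last by split=> // a b c d; rewrite sdE !sdN; ring.
move=> i j; have h := onb i j; move: h; rewrite !mxE.
by elim/ord4_ind: i; elim/ord4_ind: j; rewrite /tetrad_vec /= ?gNl ?gNr ?opprK //
  => ->; rewrite oppr0.
Qed.

Lemma future_petrov_form_exists (tau : vec R) : 0 < gdot g tau tau ->
  exists v x y z (s1 s2 s3 : C), [/\ future_unit g tau v,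
   petrov_canonical_form g Cw v x y z s1 s2 s3, s1 != s2, s2 != s3 & s3 != s1].
Proof.
move=> tau_pos; have [v [x [y [z [s1 [s2 [s3 [cf h12 h23 h31]]]]]]]] := petrov_form_exists.
have onb : orthonormal_frame g (tetrad_vec v x y z) := cf.1.
have unit_of u : petrov_canonical_form g Cw u x y z s1 s2 s3 -> gdot g u u = 1.
  by move=> cu; have := cu.1 i0 i0; rewrite mxE.
(* A [tau] orthogonal to [v] would have spatial coordinates only, hence a nonpositive norm. *)
have vtau : gdot g v tau != 0.
  apply/eqP => h; move: tau_pos; rewrite (gdot_coord onb) sum4 !sgnE.
  have -> : frame_coord g (tetrad_vec v x y z) tau i0 = 0 by rewrite /frame_coord h mulr0.
  by move: (frame_coord _ _ _ i1) (frame_coord _ _ _ i2) (frame_coord _ _ _ i3) => a b c; nra.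
have [vp|vn] := ltP 0 (gdot g v tau).
  by exists v, x, y, z, s1, s2, s3; split=> //; split=> //; apply: unit_of.
exists (fun a => - v a), x, y, z, s1, s2, s3.
have cf' := petrov_form_opp cf; split=> //; split; first exact: unit_of.
have -> : gdot g (fun a => - v a) tau = - gdot g v tau.
  by rewrite /gdot -sumrN; apply: eq_bigr => a _; rewrite -sumrN; apply: eq_bigr => b _; ring.
by rewrite oppr_gt0 lt_def eq_sym vtau.
Qed.

End Existence.

Unset Implicit Arguments.

Theorem theorem3 (R : rcfType) (g : 'M[R]_4) (tau : vec R) (Cw : tensor4 R) :
  lorentzian g -> 0 < gdot g tau tau ->
  weyl g Cw -> petrov_typeI g Cw ->
  (forall u : vec R, future_unit g tau u ->
     (br_aligned g Cw u <-> exists x y z, petrov_canonical_tetrad g Cw u x y z) /\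
     ((exists x y z, petrov_canonical_tetrad g Cw u x y z) <->
        (forall t : vec R, future_unit g tau t -> t <> u ->
           br_quartic g Cw u < br_quartic g Cw t))) /\
  (forall (v x y z : vec R) (s1 s2 s3 : R[i]),
     future_unit g tau v -> petrov_canonical_form g Cw v x y z s1 s2 s3 ->
     br_quartic g Cw v = petrov_value s1 s2 s3 /\
     (forall t : vec R, future_unit g tau t ->
        petrov_value s1 s2 s3 <= br_quartic g Cw t)).
Proof.
move=> _ tau_pos wC typeI; split; last first.
  move=> v x y z s1 s2 s3 _ cf; split; first exact: br_quartic_timelike cf.
  by move=> t [ht _]; exact: petrov_value_min cf _ ht.
(* Each of the three conditions on [u] will be shown to amount to u = v for this fixed [v]. *)
have [v [x [y [z [s1 [s2 [s3 [fv cf h12 h23 h31]]]]]]]] :=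
  future_petrov_form_exists wC typeI tau_pos.
have canon_v : exists x y z, petrov_canonical_tetrad g Cw v x y z.
  by exists x, y, z, s1, s2, s3.
have aligned_eq u : future_unit g tau u -> br_aligned g Cw u -> u = v.
  by move=> fu; exact: (aligned_timelike cf h12 h23 h31 fv fu).
have canon_aligned u : (exists x y z, petrov_canonical_tetrad g Cw u x y z) -> br_aligned g Cw u.
  by move=> [x' [y' [z' [s1' [s2' [s3' cf']]]]]]; exact: canonical_aligned cf'.
have strict t : future_unit g tau t -> t <> v -> br_quartic g Cw v < br_quartic g Cw t.
  by move=> ft tv; rewrite (br_quartic_timelike cf); apply: (petrov_value_lt cf h12 h23 h31 fv ft tv).
move=> u fu; split; split.
- by move=> al; rewrite (aligned_eq u fu al).
- exact: canon_aligned.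
- by move=> cu t ft; rewrite (aligned_eq u fu (canon_aligned u cu)); exact: strict.
(* Two distinct strict minima would each have a value below the other. *)
move=> umin; have [->//|uv] := vec_eq_dec u v.
have vu : v <> u by move=> vu; apply: uv.
by have := lt_trans (umin v fv vu) (strict u fu uv); rewrite ltxx.
Qed.
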